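(* Let $S=\operatorname{diag}(M_{11},\dots,M_{N_{vi}N_{vi}})^{1/2}$ be the Jacobi preconditioner of the FVEM mass matrix $M$. Then $$\kappa(S^{-1}MS^{-1})\le\frac{1}{(m_1-m_2)(d+1)},$$ a bound independent of the mesh.
   Context: $\mathcal{T}_h$ is a simplicial mesh of a bounded polyhedral domain $\Omega\subset\mathbb{R}^d$ with interior vertices $P_1,\dots,P_{N_{vi}}$ and continuous piecewise linear nodal basis functions $\phi_j$. Dual mesh: for an element $K$ with barycentric coordinates $\lambda$, $K^*_P\cap K=\{x\in K:\lambda_P\ge\lambda_Q\ \forall Q\}$, $K^*_P$ their union. FVEM mass matrix $M=(M_{ij})_{i,j=1}^{N_{vi}}$, $M_{ij}=\int_{K^*_{P_i}}\phi_j\,dx$ (symmetric positive definite). $m_1=\frac{1}{(d+1)^3}\big(1+(d+1)\sum_{k=1}^d\frac1k\big)$, $m_2=\frac{1}{d(d+1)^3}\big(d^2+2d-(d+1)\sum_{k=1}^d\frac1k\big)$. $\kappa$ is the spectral condition number $\lambda_{\max}/\lambda_{\min}$. *)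

(* Defs.v *)
From mathcomp Require Import all_boot all_order all_algebra.
From mathcomp Require Import all_classical all_reals all_analysis.
Set Implicit Arguments. Unset Strict Implicit. Unset Printing Implicit Defensive.
Import Order.TTheory GRing.Theory Num.Theory.
Import numFieldNormedType.Exports.
Local Open Scope ring_scope.
Local Open Scope classical_set_scope.

Section FVEM.
Variable R : realType.
Variable d : nat.

Definition Rpoint := 'rV[R]_d.

Definition simplex_mx (v : 'I_d.+1 -> Rpoint) : 'M[R]_d.+1 :=
  row_mx (const_mx 1 : 'M[R]_(d.+1, 1)) (\matrix_(i < d.+1) v i).

Definition nondegenerate (v : 'I_d.+1 -> Rpoint) : Prop :=
  simplex_mx v \in unitmx.

(* barycentric coordinates: the unique lambda with sum_i lambda_i = 1 and
   sum_i lambda_i v_i = x, i.e. lambda *m simplex_mx v = [1 | x] *)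
Definition bary (v : 'I_d.+1 -> Rpoint) (x : Rpoint) : 'rV[R]_d.+1 :=
  row_mx (1 : 'M[R]_1) x *m invmx (simplex_mx v).

Definition in_simplex (v : 'I_d.+1 -> Rpoint) (x : Rpoint) : Prop :=
  forall i, 0 <= bary v x 0 i.

Section Mesh.
Variables (nv ne : nat).
Variable V : 'I_nv -> Rpoint.
Variable E : 'I_ne -> 'I_d.+1 -> 'I_nv.

Definition elem (k : 'I_ne) : 'I_d.+1 -> Rpoint := fun i => V (E k i).

Definition Omega_bar : set Rpoint :=
  \bigcup_(k in [set: 'I_ne]) [set x | in_simplex (elem k) x].

Definition Omega : set Rpoint := interior Omega_bar.

Definition simplicial_mesh : Prop :=
  injective V /\
      (forall k, injective (E k)) /\
      (forall k, nondegenerate (elem k)) /\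
      (forall j, exists k i, E k i = j) /\
      (forall k l, k != l -> ~ (forall i, exists i', E k i = E l i')) /\
      (* conformity: K_k /\ K_l is the face spanned by the common vertices *)
      (forall k l x, in_simplex (elem k) x -> in_simplex (elem l) x ->
         forall i, (forall i', E l i' != E k i) -> bary (elem k) x 0 i = 0) /\
      connected Omega.

Definition nodal_basis (phi : 'I_nv -> Rpoint -> R) : Prop :=
  (forall j k x, in_simplex (elem k) x ->
     phi j x = \sum_(i < d.+1) (E k i == j)%:R * bary (elem k) x 0 i)
  /\ (forall j x, ~ Omega_bar x -> phi j x = 0).

Definition dual_cell (j : 'I_nv) : set Rpoint :=
  [set x | exists k i, E k i = j /\ in_simplex (elem k) x /\
           forall i', bary (elem k) x 0 i' <= bary (elem k) x 0 i].

Definition interior_vertices : {set 'I_nv} := [set j | `[< Omega (V j) >]].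
Definition Nvi := #|interior_vertices|.
Definition ivertex (i : 'I_Nvi) : 'I_nv := enum_val i.

End Mesh.

(* Lebesgue integral over R^d of a nonnegative function, as the iterated
   integral (Tonelli) of the 1-dimensional Lebesgue measure *)
Fixpoint iint (n : nat) (f : seq R -> \bar R) : \bar R :=
  match n with
  | 0 => f [::]
  | n'.+1 => (\int[lebesgue_measure]_t iint n' (fun s => f (t :: s)))%E
  end.

Definition integral_Rd (f : Rpoint -> \bar R) : \bar R :=
  iint d (fun s => f (\row_(i < d) nth 0 s i)).

Definition fvem_mass nv ne (V : 'I_nv -> Rpoint) (E : 'I_ne -> 'I_d.+1 -> 'I_nv)
  (phi : 'I_nv -> Rpoint -> R) : 'M[R]_(Nvi V E) :=
  \matrix_(i < Nvi V E, j < Nvi V E) fine (integral_Rd (fun x =>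
     (\1_(dual_cell V E (ivertex i)) x * phi (ivertex j) x)%:E)).

End FVEM.

Definition jacobi_scaled (R : realType) n (A : 'M[R]_n) : 'M[R]_n :=
  let S := diag_mx (\row_i Num.sqrt (A i i)) in invmx S *m A *m invmx S.

Definition cond_number (R : realType) n (A : 'M[R]_n) : R :=
  sup [set a | eigenvalue A a] / inf [set a | eigenvalue A a].

Definition harm (R : realType) (d : nat) : R := \sum_(1 <= k < d.+1) (k%:R)^-1.

Definition m1 (R : realType) (d : nat) : R :=
  ((d.+1%:R) ^+ 3)^-1 * (1 + d.+1%:R * harm R d).

Definition m2 (R : realType) (d : nat) : R :=
  (d%:R * (d.+1%:R) ^+ 3)^-1 *
  (d%:R ^+ 2 + 2 * d%:R - d.+1%:R * harm R d).

(* Main.v *)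
(* Restricted to an element K, the entries of the mass matrix are integrals of
   polynomials in the barycentric coordinates over the regions where one of them
   dominates. The iterated integral is multiplied by a constant under an
   invertible affine map, so these integrals are the same for all elements up to
   the volume of K, and they are invariant under permutations of the vertices.
   The barycentric coordinates l_0 >= l_1 >= ... >= l_d of K fill the simplex
   with vertices w_k = (v_0 + ... + v_k) / (k + 1), on which the mean of l_0 is
   (1 + 1/2 + ... + 1/(d+1)) / (d + 1); this gives |K| m1 and |K| m2.
   The element matrix therefore lies between |K| (m1 - m2) and |K| (m1 + d m2) =
   |K| / (d + 1), while the diagonal of the mass matrix collects |K| m1: all
   eigenvalues of the preconditioned matrix are between (m1 - m2) / m1 and
   1 / ((d + 1) m1). *)
Require Import Defs.
From mathcomp Require Import all_boot all_order all_algebra fingroup perm.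
From mathcomp Require Import all_classical all_reals all_analysis.
From mathcomp Require Import measurable_realfun ring lra zify.
Import Order.TTheory GRing.Theory Num.Theory.
Local Open Scope ring_scope.

(** * Iterated integrals of functions on sequences *)

(** Only ratios of integrals over one element matter, so the factor by which an affine map scales
    integrals stays an unspecified positive constant, eliminated by comparing two integrands. Its
    existence must be drawn from a definition by nested one-dimensional integrals: Tonelli brings
    any coordinate to the front, uniqueness of Lebesgue measure handles an affine substitution in
    it, and every invertible matrix is a product of such substitutions. Two obstacles shape the
    rest. Elements and dual cells overlap along faces and ties, so these must be shown to lie in
    null hyperplanes. The basis functions are known only element by element, so the integral is
    compared without measurability of the smaller function. The element matrix is |K| ((m1 - m2) I +
    m2 J) with J all ones. Its eigenvalues are |K| times m1 - m2 and, on constants, m1 + d m2; the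
    latter is 1 / (d + 1) because barycentric coordinates sum to 1 and each dual cell takes an equal
    share of K. *)

Section IteratedIntegral.
Variable R : realType.
Notation RT := (measurableTypeR R).
Notation leb := (@lebesgue_measure R).
Local Open Scope ereal_scope.
Implicit Types (f g : seq R -> \bar R) (n : nat).

(** Measurability is tested on [n]-tuples, with their product sigma-algebra: these are the only
    lists that [iint n] passes to [f]. *)
Definition meas_seq n f := measurable_fun [set: n.-tuple RT] (fun t => f t).

(** The integral of a nonnegative function is a supremum over the simple functions below it, and
    those below [f] are below [g]. This is what later allows an integrand of unknown measurability
    to be squeezed. *)
Lemma integral_le_nomeas (f g : R -> \bar R) :
  (forall t, 0 <= f t) -> (forall t, f t <= g t) ->
  \int[leb]_t f t <= \int[leb]_t g t.
Proof.
move=> f0 fg.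
have g0 t : 0 <= g t by exact: le_trans (f0 t) (fg t).
rewrite !ge0_integralTE//; apply: ereal_sup_le => _ [h hf <-].
by exists h => // t; exact: le_trans (hf t) (fg t).
Qed.

Lemma iint_ge0 n f : (forall s, 0 <= f s) -> 0 <= iint n f.
Proof.
elim: n f => [|n IH] f f0 /=; first exact: f0.
by apply: integral_ge0 => t _; exact: IH.
Qed.

Lemma le_iint n f g : (forall s, 0 <= f s) ->
  (forall s, size s = n -> f s <= g s) -> iint n f <= iint n g.
Proof.
elim: n f g => [|n IH] f g f0 fg /=; first exact: fg.
apply: integral_le_nomeas => t; first exact: iint_ge0.
by apply: IH => // s sn; apply: fg => /=; rewrite sn.
Qed.

Lemma eq_iint n f g : (forall s, size s = n -> f s = g s) ->
  iint n f = iint n g.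
Proof.
elim: n f g => [|n IH] f g fg /=; first exact: fg.
by apply: eq_integral => t _; apply: IH => s sn; apply: fg => /=; rewrite sn.
Qed.

Lemma meas_seq_comp d d' (X : measurableType d) (Z : measurableType d') n
    (f : seq R -> Z) (G : X -> seq R) :
  measurable_fun [set: n.-tuple RT] (fun t => f t) -> (forall x, size (G x) = n) ->
  (forall i, (i < n)%N -> measurable_fun [set: X] (fun x => nth 0%R (G x) i : RT)) ->
  measurable_fun [set: X] (fun x => f (G x)).
Proof.
move=> mf sG mG.
have sG' x : size (G x) == n by rewrite sG.
rewrite (_ : (fun x => f (G x)) =
  (fun t : n.-tuple RT => f t) \o (fun x => Tuple (sG' x) : n.-tuple RT))//.
apply: measurableT_comp => //.
apply/measurable_fun_tnthP => i.
rewrite (_ : _ \o _ = fun x => nth 0%R (G x) i); first exact: mG.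
by apply/funext => x /=; rewrite (tnth_nth 0%R).
Qed.

Lemma measurable_nth_tuple n i :
  measurable_fun [set: n.-tuple RT] (fun t => nth 0%R t i : RT).
Proof.
have [ltin|lein] := ltnP i n.
  rewrite (_ : (fun _ => _) = fun t : n.-tuple RT => tnth t (Ordinal ltin)).
    exact: measurable_tnth.
  by apply/funext => t; rewrite (tnth_nth 0%R).
rewrite (_ : (fun _ => _) = cst 0%R) //.
by apply/funext => t; rewrite nth_default// size_tuple.
Qed.

Lemma measurable_nth_snd d (X : measurableType d) n i :
  measurable_fun [set: X * n.-tuple RT] (fun p => nth 0%R p.2 i : RT).
Proof.
apply: (@measurableT_comp _ _ _ _ _ _ (fun t : n.-tuple RT => nth 0%R t i : RT)).
  exact: measurable_nth_tuple.
exact: measurable_snd.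
Qed.

Lemma meas_param_comp d d' (X : measurableType d) (Y : measurableType d') n
    (F : X -> seq R -> \bar R) (h : Y -> X) (G : Y -> seq R) :
  measurable_fun [set: X * n.-tuple RT] (fun p => F p.1 p.2) ->
  measurable_fun [set: Y] h -> (forall y, size (G y) = n) ->
  (forall i, (i < n)%N -> measurable_fun [set: Y] (fun y => nth 0%R (G y) i : RT)) ->
  measurable_fun [set: Y] (fun y => F (h y) (G y)).
Proof.
move=> mF mh sG mG.
have sG' y : size (G y) == n by rewrite sG.
rewrite (_ : (fun y => F (h y) (G y)) = (fun p : X * n.-tuple RT => F p.1 p.2) \o
  (fun y => (h y, Tuple (sG' y) : n.-tuple RT)))//.
apply: measurableT_comp => //.
apply: (@measurable_fun_pair _ _ _ Y X (n.-tuple RT) h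
  (fun y => Tuple (sG' y) : n.-tuple RT)) => //.
apply/measurable_fun_tnthP => i.
rewrite (_ : _ \o _ = fun y => nth 0%R (G y) i); first exact: mG.
by apply/funext => y /=; rewrite (tnth_nth 0%R).
Qed.

(** The parameter space is arbitrary because each induction step absorbs the outermost integration
    variable into it. *)
Lemma measurable_iint d (X : measurableType d) n (F : X -> seq R -> \bar R) :
  (forall x s, 0 <= F x s) ->
  measurable_fun [set: X * n.-tuple RT] (fun p => F p.1 p.2) ->
  measurable_fun [set: X] (fun x => iint n (F x)).
Proof.
elim: n d X F => [|n IH] d X F F0 mF /=.
  exact: (meas_param_comp _ _ X X 0 F id (fun=> [::]) mF).
apply: (@measurable_fun_fubini_tonelli_F _ _ X RT R leb
  (fun p => iint n (fun s => F p.1 (p.2 :: s)))).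
  apply: (IH _ (X * RT)%type (fun p s => F p.1 (p.2 :: s))) => //.
  apply: (meas_param_comp _ _ X _ n.+1 F (fun q => q.1.1)
    (fun q : (X * RT) * n.-tuple RT => q.1.2 :: q.2) mF) => /= [|q|[|i] _].
  - by apply: measurableT_comp.
  - by rewrite size_tuple.
  - by apply: measurableT_comp.
  - exact: measurable_nth_snd.
by move=> p; apply: iint_ge0.
Qed.

Lemma meas_seq_cons n f (t : R) : meas_seq n.+1 f ->
  meas_seq n (fun s => f (t :: s)).
Proof.
move=> mf; apply: (meas_seq_comp _ _ _ _ _ _ _ mf) => /= [x|[|i] _].
- by rewrite size_tuple.
- exact: measurable_cst.
- exact: measurable_nth_tuple.
Qed.

Lemma measurable_iint_cons n f : (forall s, 0 <= f s) -> meas_seq n.+1 f ->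
  measurable_fun [set: RT] (fun t => iint n (fun s => f (t :: s))).
Proof.
move=> f0 mf; apply: (measurable_iint _ RT n (fun t s => f (t :: s))) => //.
apply: (meas_seq_comp _ _ _ _ _ _ _ mf) => /= [x|[|i] _].
- by rewrite size_tuple.
- exact: measurable_fst.
- exact: measurable_nth_snd.
Qed.

Lemma iintD n f g : (forall s, 0 <= f s) -> (forall s, 0 <= g s) ->
  meas_seq n f -> meas_seq n g ->
  iint n (fun s => f s + g s) = iint n f + iint n g.
Proof.
elim: n f g => [|n IH] f g f0 g0 mf mg //=.
rewrite -ge0_integralD //=.
- by apply: eq_integral => t _; rewrite IH//; exact: meas_seq_cons.
- by move=> t _; exact: iint_ge0.
- exact: measurable_iint_cons.
- by move=> t _; exact: iint_ge0.
- exact: measurable_iint_cons.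
Qed.

Lemma iintZ n f (k : \bar R) : 0 <= k -> (forall s, 0 <= f s) -> meas_seq n f ->
  iint n (fun s => k * f s) = k * iint n f.
Proof.
move=> k0; elim: n f => [|n IH] f f0 mf //=.
rewrite -ge0_integralZl //=.
- by apply: eq_integral => t _; rewrite IH//; exact: meas_seq_cons.
- exact: measurable_iint_cons.
- by move=> t _; exact: iint_ge0.
Qed.

Definition insert (j : nat) (t : R) (s : seq R) := take j s ++ t :: drop j s.

Lemma size_insert j t s : size (insert j t s) = (size s).+1.
Proof. by rewrite size_cat /= addnS -size_cat cat_take_drop. Qed.

Lemma nth_insert j t s i : (j <= size s)%N ->
  nth 0%R (insert j t s) i =
  if (i < j)%N then nth 0%R s i else if i == j then t else nth 0%R s i.-1.
Proof.
move=> js; rewrite nth_cat size_takel//.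
have [ij|ji] := ltnP i j; first by rewrite nth_take.
have [->|ne] := eqVneq i j; first by rewrite subnn.
have lt : (j < i)%N by rewrite ltn_neqAle eq_sym ne.
rewrite -(subnSK lt) /= nth_drop; congr nth; lia.
Qed.

Lemma measurable_nth_insert d (X : measurableType d) n (h : X -> R) j i :
  (j <= n)%N -> measurable_fun [set: X] (h : X -> RT) ->
  measurable_fun [set: X * n.-tuple RT]
    (fun p => nth 0%R (insert j (h p.1) p.2) i : RT).
Proof.
move=> jn mh.
rewrite (_ : (fun _ => _) = fun p : X * n.-tuple RT =>
  if (i < j)%N then nth 0%R p.2 i else if i == j then h p.1 else nth 0%R p.2 i.-1).
  case: (i < j)%N; first exact: measurable_nth_snd.
  case: (i == j); last exact: measurable_nth_snd.
  by apply: measurableT_comp.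
by apply/funext => p; rewrite nth_insert// size_tuple.
Qed.

Lemma measurable_insert n f j : (j <= n)%N -> meas_seq n.+1 f ->
  measurable_fun [set: RT * n.-tuple RT] (fun p => f (insert j p.1 p.2)).
Proof.
move=> jn mf; apply: (meas_seq_comp _ _ _ _ _ _ _ mf) => /= [x|i _].
  by rewrite size_insert size_tuple.
exact: (measurable_nth_insert _ _ _ id).
Qed.

(** Each induction step moves the variable past one other by Tonelli. A substitution can therefore
    act on any single coordinate. *)
Lemma iint_insert n f j : (j <= n)%N -> (forall s, 0 <= f s) -> meas_seq n.+1 f ->
  iint n.+1 f = \int[leb]_t iint n (fun s => f (insert j t s)).
Proof.
elim: j n f => [|j IH] n f jn f0 mf.
  by apply: eq_integral => t _; apply: eq_iint => s _; rewrite /insert take0 drop0.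
case: n jn mf => [//|n] jn mf.
transitivity (\int[leb]_u \int[leb]_t iint n (fun s => f (u :: insert j t s))).
  apply: eq_integral => u _.
  by apply: (IH n (fun s => f (u :: s))) => //; exact: meas_seq_cons.
rewrite (@fubini_tonelli _ _ RT RT R leb leb
  (fun p => iint n (fun s => f (p.1 :: insert j p.2 s)))) //.
  apply: (measurable_iint _ (RT * RT)%type n
    (fun p s => f (p.1 :: insert j p.2 s))) => //.
  apply: (meas_seq_comp _ _ _ _ _ _ _ mf) => /= [x|[|i] _].
  - by rewrite size_insert size_tuple.
  - by apply: measurableT_comp.
  - by apply: (measurable_nth_insert _ _ _ snd).
by move=> p; exact: iint_ge0.
Qed.

(** The opposite move: the distinguished variable becomes the innermost one, so that a
    one-dimensional integral remains with all other coordinates frozen. *)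
Lemma integral_iint n (F : R -> seq R -> \bar R) : (forall t s, 0 <= F t s) ->
  measurable_fun [set: RT * n.-tuple RT] (fun p => F p.1 p.2) ->
  \int[leb]_t iint n (F t) = iint n (fun s => \int[leb]_t F t s).
Proof.
elim: n F => [//|n IH] F F0 mF /=.
rewrite (@fubini_tonelli _ _ RT RT R leb leb
  (fun p => iint n (fun s => F p.1 (p.2 :: s)))) //=.
- apply: eq_integral => u _; apply: (IH (fun t s => F t (u :: s))) => //.
  apply: (meas_param_comp _ _ RT _ n.+1 F fst
    (fun q : RT * n.-tuple RT => u :: q.2) mF) => /= [//|q|[|i] _].
  - by rewrite size_tuple.
  - exact: measurable_cst.
  - exact: measurable_nth_snd.
- apply: (measurable_iint _ (RT * RT)%type n (fun p s => F p.1 (p.2 :: s))) => //.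
  apply: (meas_param_comp _ _ RT _ n.+1 F (fun q => q.1.1)
    (fun q : (RT * RT) * n.-tuple RT => q.1.2 :: q.2) mF) => /= [|q|[|i] _].
  - by apply: measurableT_comp.
  - by rewrite size_tuple.
  - by apply: measurableT_comp.
  - exact: measurable_nth_snd.
- by move=> p; exact: iint_ge0.
Qed.

End IteratedIntegral.

(** * Affine substitution in one coordinate *)

Section OneCoordinate.
Variable R : realType.
Notation RT := (measurableTypeR R).
Notation leb := (@lebesgue_measure R).
Local Open Scope classical_set_scope.
Local Open Scope ereal_scope.

Lemma measurable_affine (a b : R) :
  measurable_fun [set: RT] (fun t => a * t + b : RT)%R.
Proof. by apply: measurable_funD => //; apply: measurable_funM. Qed.

(** The scaled pushforward agrees with Lebesgue measure on the intervals []x, y]], which determine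
    it. For [a < 0] the preimage is closed on the left instead, with the same length. *)
Lemma lebesgue_measure_affine (a b : R) (A : set R) : a != 0%R -> measurable A ->
  (`|a|%:E * leb ((fun t => a * t + b)%R @^-1` A) = leb A).
Proof.
move=> a0 mA.
pose phi := (fun t => a * t + b : RT)%R.
have mphi : measurable_fun [set: RT] phi by exact: measurable_affine.
have [mu muE] : exists mu : {measure set RT -> \bar R},
    forall B, mu B = `|a|%:E * pushforward leb phi B.
  by unshelve eexists (mscale (NngNum (normr_ge0 a)) (pushforward leb phi)).
rewrite -[LHS]muE.
apply/esym; apply: (@lebesgue_measure_unique R mu) => // _ [[x y]] _ <-.
rewrite muE /pushforward /phi.
have [agt0|alt0] := ltP 0%R a.
  have -> : (fun t => a * t + b)%R @^-1` `]x, y] = `]((x - b) / a)%R, ((y - b) / a)%R].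
    apply/seteqP; split=> t /=; rewrite !in_itv /= ltr_pdivrMr// ler_pdivlMr//;
      by rewrite ltrBlDr lerBrDr mulrC.
  rewrite !lebesgue_measure_itv /= !lte_fin ltr_pM2r ?invr_gt0// ltrD2r.
  case: ifP => _; last by rewrite mule0.
  rewrite -!EFinD -EFinM gtr0_norm//; congr _%:E; field; exact: lt0r_neq0.
have {}alt0 : (a < 0)%R by rewrite lt_neqAle a0.
have -> : (fun t => a * t + b)%R @^-1` `]x, y] = `[((y - b) / a)%R, ((x - b) / a)%R[.
  apply/seteqP; split=> t /=; rewrite !in_itv /= ltr_ndivlMr// ler_ndivrMr//;
    by rewrite ltrBlDr lerBrDr mulrC andbC.
rewrite !lebesgue_measure_itv /= !lte_fin ltr_nM2r ?invr_lt0// ltrD2r.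
case: ifP => _; last by rewrite mule0.
rewrite -!EFinD -EFinM ltr0_norm//; congr _%:E; field; exact: ltr0_neq0.
Qed.

Lemma ge0_integral_affine (a b : R) (g : R -> \bar R) : a != 0%R ->
  (forall t, 0 <= g t) -> measurable_fun [set: RT] g ->
  \int[leb]_t g (a * t + b)%R = `|a|^-1%:E * \int[leb]_t g t.
Proof.
move=> a0 g0 mg.
pose phi := (fun t => a * t + b : RT)%R.
have mphi : measurable_fun [set: RT] phi by exact: measurable_affine.
have an0 : `|a|%R != 0%R by rewrite normr_eq0.
transitivity (\int[pushforward leb phi]_t g t).
  by rewrite ge0_integral_pushforward// preimage_setT.
have ia : (0 <= `|a|^-1)%R by rewrite invr_ge0.
rewrite -[RHS](@ge0_integral_mscale _ _ _ leb setT measurableT (NngNum ia))//.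
apply: eq_measure_integral => A mA _.
rewrite -[RHS]/(`|a|^-1%:E * leb A) -(lebesgue_measure_affine a b)//.
by rewrite muleA -EFinM mulVf// mul1e.
Qed.

Lemma nth_delete j (s : seq R) i : (j < size s)%N ->
  nth 0%R (take j s ++ drop j.+1 s) i = nth 0%R s (if (i < j)%N then i else i.+1).
Proof.
move=> js; rewrite nth_cat size_takel; last exact: ltnW.
have [ij|ji] := ltnP i j; first by rewrite nth_take.
by rewrite nth_drop addSn subnKC.
Qed.

Lemma size_delete j (s : seq R) : (j < size s)%N ->
  size (take j s ++ drop j.+1 s) = (size s).-1.
Proof.
move=> js; rewrite size_cat size_drop size_takel; last exact: ltnW.
by case: (size s) js => // m jm; rewrite subSS subnKC.
Qed.

(** [l] receives the list without entry [j]: once the other coordinates are frozen, the map is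
    affine in the only coordinate that changes. *)
Definition change_coord (j : nat) (a : R) (l : seq R -> R) (s : seq R) :=
  insert R j (a * nth 0 s j + l (take j s ++ drop j.+1 s))%R
    (take j s ++ drop j.+1 s).

Lemma delete_insert j t (s : seq R) : (j <= size s)%N ->
  take j (insert R j t s) ++ drop j.+1 (insert R j t s) = s.
Proof.
move=> js; rewrite /insert take_size_cat ?size_takel// -cat_rcons drop_size_cat.
  by rewrite cat_take_drop.
by rewrite size_rcons size_takel.
Qed.

Lemma change_coord_insert j a l t s : (j <= size s)%N ->
  change_coord j a l (insert R j t s) = insert R j (a * t + l s)%R s.
Proof.
by move=> js; rewrite /change_coord delete_insert// nth_insert// ltnn eqxx.
Qed.

(** With coordinate [j] integrated innermost, [l s] is a constant shift, and the one-dimensional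
    affine substitution applies for each [s]. *)
Lemma iint_change_coord n j (a : R) (l : seq R -> R) (f : seq R -> \bar R) :
  (j <= n)%N -> a != 0%R ->
  (forall s, 0 <= f s) -> meas_seq R n.+1 f ->
  measurable_fun [set: n.-tuple RT] (fun s => l s : RT) ->
  iint n.+1 (f \o change_coord j a l) = `|a|^-1%:E * iint n.+1 f.
Proof.
move=> jn a0 f0 mf ml.
have mG : measurable_fun [set: RT * n.-tuple RT]
    (fun p => f (insert R j (a * p.1 + l p.2)%R p.2)).
  apply: (meas_seq_comp _ _ _ _ _ _ _ _ mf) => /= [p|i _].
    by rewrite size_insert size_tuple.
  rewrite (_ : (fun _ => _) = fun p : RT * n.-tuple RT =>
    if (i < j)%N then nth 0%R p.2 i else
    if i == j then a * p.1 + l p.2 else nth 0%R p.2 i.-1)%R.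
    case: (i < j)%N; first exact: measurable_nth_snd.
    case: (i == j); last exact: measurable_nth_snd.
    apply: measurable_funD; first by apply: measurable_funM => //; exact: measurable_fst.
    by apply: (measurableT_comp ml); exact: measurable_snd.
  by apply/funext => p; rewrite nth_insert// size_tuple.
have mf' : meas_seq R n.+1 (f \o change_coord j a l).
  have md : forall i, measurable_fun [set: n.+1.-tuple RT]
      (fun s => nth 0%R (take j s ++ drop j.+1 s) i : RT).
    move=> i; rewrite (_ : (fun _ => _) = fun s : n.+1.-tuple RT =>
      nth 0%R s (if (i < j)%N then i else i.+1) : RT).
      exact: measurable_nth_tuple.
    by apply/funext => s; rewrite nth_delete// size_tuple.
  have ml' : measurable_fun [set: n.+1.-tuple RT]
      (fun s => l (take j s ++ drop j.+1 s) : RT).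
    apply: (meas_seq_comp _ _ _ _ _ _ _ _ ml) => // s.
    by rewrite size_delete size_tuple.
  apply: (meas_seq_comp _ _ _ _ _ _ _ _ mf) => /= [s|i iln].
    by rewrite size_insert size_delete size_tuple.
  rewrite (_ : (fun _ => _) = fun s : n.+1.-tuple RT =>
    if (i < j)%N then nth 0%R (take j s ++ drop j.+1 s) i else
    if i == j then (a * nth 0 s j + l (take j s ++ drop j.+1 s))%R
    else nth 0%R (take j s ++ drop j.+1 s) i.-1).
    case: (i < j)%N => //; case: (i == j) => //.
    apply: measurable_funD => //; apply: measurable_funM => //.
    exact: measurable_nth_tuple.
  by apply/funext => s; rewrite nth_insert// size_delete size_tuple.
rewrite [LHS](iint_insert _ _ (f \o change_coord j a l) _ jn)//.
rewrite [in RHS](iint_insert _ _ f _ jn)//.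
transitivity (\int[leb]_t iint n (fun s => f (insert R j (a * t + l s)%R s))).
  apply: eq_integral => t _; apply: eq_iint => s sn /=.
  by rewrite change_coord_insert// sn.
rewrite (integral_iint _ _ (fun t s => f (insert R j (a * t + l s)%R s)))//.
rewrite (integral_iint _ _ (fun t s => f (insert R j t s)))//; last first.
  exact: measurable_insert.
rewrite -iintZ.
- apply: eq_iint => s sn.
  rewrite (ge0_integral_affine a (l s) (fun t => f (insert R j t s)))//.
  apply: (meas_seq_comp _ _ _ _ _ _ _ _ mf) => /= [t|i _].
    by rewrite size_insert sn.
  rewrite (_ : (fun _ => _) = fun t : RT =>
    if (i < j)%N then nth 0%R s i else
    if i == j then t else nth 0%R s i.-1)%R.
    by case: (i < j)%N; case: (i == j).
  by apply/funext => p; rewrite nth_insert// sn.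
- by rewrite lee_fin invr_ge0.
- by move=> s; exact: integral_ge0.
- apply: (@measurable_fun_fubini_tonelli_G _ _ RT _ R leb
    (fun p : RT * n.-tuple RT => f (insert R j p.1 p.2))) => //.
  exact: measurable_insert.
- by move=> s; exact: f0.
Qed.

Lemma integral_itv_indic (a : R) : (0 <= a)%R ->
  \int[leb]_t (\1_(`[0, a]%classic : set R) t)%:E = a%:E.
Proof.
move=> a0; rewrite integral_indic// setIT.
transitivity (leb `[0%R, a]) => //; rewrite lebesgue_measure_itv /= lte_fin oppr0 adde0.
by case: ltP => // a1; congr _%:E; apply/eqP; rewrite eq_le a0 a1.
Qed.

(** Boxes are the only sets whose volume is computed directly; they bound the volume of a reference
    simplex from both sides. *)
Lemma iint_box n (a : R) : (0 <= a)%R ->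
  iint n (fun s => (all (fun t => 0 <= t <= a) s)%R%:R%:E) = (a ^+ n)%:E.
Proof.
move=> a0; elim: n => [//|n IH] /=.
transitivity (\int[leb]_t ((a ^+ n)%:E * (\1_(`[0%R, a]%classic : set R) t)%:E)).
  apply: eq_integral => t _; rewrite indicE.
  have -> : (t \in (`[0%R, a]%classic : set R)) = (0 <= t <= a)%R.
    by apply/idP/idP; rewrite inE /= in_itv.
  case: (0 <= t <= a)%R => /=; first by rewrite mule1 IH.
  rewrite mule0; transitivity (iint n (fun s : seq R => 0%:E * 0%:E : \bar R)).
    by apply: eq_iint => s _; rewrite mule0.
  by rewrite iintZ ?mul0e//; exact: measurable_cst.
rewrite ge0_integralZl//=.
- by rewrite integral_itv_indic// -EFinM exprSr.
- by apply/measurable_EFinP; exact: measurable_indic.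
- by rewrite lee_fin exprn_ge0.
Qed.

End OneCoordinate.

(** * Affine changes of variables *)

Section RowIntegral.
Variable R : realType.
Notation RT := (measurableTypeR R).

Definition row_of_seq d (s : seq R) : 'rV[R]_d := \row_(i < d) nth 0 s i.

Definition meas_row d (f : 'rV[R]_d -> R) :=
  measurable_fun [set: d.-tuple RT] (fun t => f (row_of_seq d t) : RT).

Definition int_row d (f : 'rV[R]_d -> R) : \bar R :=
  integral_Rd (fun x => (f x)%:E).

Lemma int_rowE d f : int_row d f = iint d (fun s => (f (row_of_seq d s))%:E).
Proof. by []. Qed.

Lemma meas_row_seq d f : meas_row d f ->
  meas_seq R d (fun s => (f (row_of_seq d s))%:E).
Proof. by move=> mf; apply/measurable_EFinP. Qed.

Lemma meas_row_coord d (i : 'I_d) : meas_row d (fun x => x 0 i).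
Proof.
rewrite /meas_row (_ : (fun _ => _) = fun t : d.-tuple RT => nth 0 t i : RT).
  exact: measurable_nth_tuple.
by apply/funext => t; rewrite mxE.
Qed.

Lemma meas_row_affine d m (A : 'M[R]_(d, m)) (b : 'rV[R]_m) f :
  meas_row m f -> meas_row d (fun x => f (x *m A + b)).
Proof.
move=> mf.
pose y (t : seq R) := row_of_seq d t *m A + b.
rewrite /meas_row (_ : (fun _ => _) =
  fun t : d.-tuple RT => f (row_of_seq m [seq y t 0 i | i <- enum 'I_m])); last first.
  apply/funext => t; congr f; apply/rowP => i.
  rewrite [RHS]mxE (nth_map i) ?nth_ord_enum// size_enum_ord//.
apply: (meas_seq_comp _ _ _ _ _ _ (fun s => f (row_of_seq m s)) _ mf) => [t|i im].
  by rewrite size_map size_enum_ord.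
rewrite (_ : (fun _ => _) = fun t : d.-tuple RT =>
    \sum_(k < d) nth 0 t k * A k (Ordinal im) + b 0 (Ordinal im)); last first.
  apply/funext => t; rewrite (nth_map (Ordinal im)) ?size_enum_ord//.
  rewrite (_ : nth _ _ _ = Ordinal im); last first.
    by apply: val_inj => /=; rewrite nth_enum_ord.
  by rewrite !mxE; congr +%R; apply: eq_bigr => k _; rewrite mxE.
apply: measurable_funD => //; apply: measurable_sum => k.
by apply: measurable_funM => //; exact: measurable_nth_tuple.
Qed.

Lemma int_row_ge0 d f : (forall x, 0 <= f x) -> (0 <= int_row d f)%E.
Proof. by move=> f0; apply: iint_ge0 => s; rewrite lee_fin. Qed.

Lemma le_int_row d f g : (forall x, 0 <= f x) -> (forall x, f x <= g x) ->
  (int_row d f <= int_row d g)%E.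
Proof.
by move=> f0 fg; apply: le_iint => s; rewrite ?lee_fin// => _; rewrite lee_fin.
Qed.

Lemma eq_int_row d f g : f =1 g -> int_row d f = int_row d g.
Proof. by move=> fg; congr int_row; apply/funext. Qed.

Lemma int_rowD d f g : (forall x, 0 <= f x) -> (forall x, 0 <= g x) ->
  meas_row d f -> meas_row d g ->
  (int_row d (fun x => f x + g x)%R = int_row d f + int_row d g)%E.
Proof.
move=> f0 g0 mf mg; rewrite !int_rowE -iintD.
- by apply: eq_iint => s _; rewrite EFinD.
- by move=> s; rewrite lee_fin.
- by move=> s; rewrite lee_fin.
- exact: meas_row_seq.
- exact: meas_row_seq.
Qed.

Lemma int_rowZ d k f : 0 <= k -> (forall x, 0 <= f x) -> meas_row d f ->
  (int_row d (fun x => k * f x)%R = k%:E * int_row d f)%E.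
Proof.
move=> k0 f0 mf; rewrite !int_rowE -iintZ.
- by apply: eq_iint => s _; rewrite EFinM.
- by rewrite lee_fin.
- by move=> s; rewrite lee_fin.
- exact: meas_row_seq.
Qed.

Lemma int_row0 d : int_row d (fun=> 0) = 0%E.
Proof.
rewrite (_ : (fun=> 0) = (fun x : 'rV_d => 0 * (fun=> 0) x)).
  by rewrite int_rowZ ?mul0e//; exact: measurable_cst.
by apply/funext => x; rewrite mul0r.
Qed.

Lemma meas_row_sum d (I : Type) (r : seq I) (P : pred I) (F : I -> 'rV[R]_d -> R) :
  (forall i, meas_row d (F i)) -> meas_row d (fun x => \sum_(i <- r | P i) F i x).
Proof.
move=> mF; rewrite /meas_row.
elim: r => [|i r IH].
  under [X in measurable_fun _ X]funext do rewrite big_nil.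
  exact: measurable_cst.
under [X in measurable_fun _ X]funext do rewrite big_cons.
by case: (P i) => //; apply: measurable_funD => //; exact: mF.
Qed.

Lemma int_row_sum d (I : Type) (r : seq I) (P : pred I) (F : I -> 'rV[R]_d -> R) :
  (forall i x, 0 <= F i x) -> (forall i, meas_row d (F i)) ->
  int_row d (fun x => \sum_(i <- r | P i) F i x) =
  (\sum_(i <- r | P i) int_row d (F i))%E.
Proof.
move=> F0 mF; elim: r => [|i r IH].
  rewrite big_nil (eq_int_row _ _ (fun=> 0)) ?int_row0// => x.
  by rewrite big_nil.
rewrite big_cons; case Pi: (P i); last first.
  by rewrite -IH; apply: eq_int_row => x; rewrite big_cons Pi.
rewrite -IH -int_rowD//; last first.
- exact: meas_row_sum.
- by move=> x; exact: sumr_ge0.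
by apply: eq_int_row => x; rewrite big_cons Pi.
Qed.

Lemma meas_rowM d f g : meas_row d f -> meas_row d g ->
  meas_row d (fun x => f x * g x).
Proof. by move=> mf mg; apply: measurable_funM. Qed.

Lemma iint_translate n (b : nat -> R) (f : seq R -> \bar R) :
  (forall s, (0 <= f s)%E) -> meas_seq R n f ->
  iint n (fun s => f (mkseq (fun i => nth 0 s i + b i) n)) = iint n f.
Proof.
elim: n b f => [//|n IH] b f f0 mf.
transitivity (\int[@lebesgue_measure R]_t
    (fun u => iint n (fun s => f (u :: s))) (1 * t + b 0%N)%R)%E.
  apply: eq_integral => t _ /=.
  rewrite -(IH (fun i => b i.+1)) //; last exact: meas_seq_cons.
  apply: eq_iint => s sn; congr f; rewrite /mkseq /= mul1r; congr cons.
  by rewrite (iotaDl 1 0) -map_comp.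
rewrite (ge0_integral_affine _ 1 (b 0%N) (fun u => iint n (fun s => f (u :: s))))//.
- by rewrite normr1 invr1 mul1e.
- by move=> t; exact: iint_ge0.
- exact: measurable_iint_cons.
Qed.

Lemma int_row_translate d (b : 'rV[R]_d) f : (forall x, 0 <= f x) -> meas_row d f ->
  int_row d (fun x => f (x + b)) = int_row d f.
Proof.
move=> f0 mf; case: d => [|n] in b f f0 mf *.
  by apply: eq_int_row => x; congr f; apply/rowP => -[].
rewrite !int_rowE.
rewrite -(iint_translate n.+1 (fun i => b 0 (inord i))
  (fun s => (f (row_of_seq n.+1 s))%:E)).
- apply: eq_iint => s _; congr ((f _)%:E); apply/rowP => i.
  by rewrite !mxE nth_mkseq// inord_val.
- by move=> s; rewrite lee_fin.
- exact: meas_row_seq.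
Qed.

(** The factor is the inverse of the absolute determinant; leaving it existential makes the property
    closed under products without determinant computations. *)
Definition scales_integral d (A : 'M[R]_d) := exists2 c : R, 0 < c &
  forall f, meas_row d f -> (forall x, 0 <= f x) ->
    (int_row d (fun x => f (x *m A)) = c%:E * int_row d f)%E.

Lemma scales_integral1 d : scales_integral d 1%:M.
Proof.
exists 1 => // f mf f0; rewrite mul1e; apply: eq_int_row => x.
by rewrite mulmx1.
Qed.

Lemma meas_row_linear d (A : 'M[R]_d) f : meas_row d f ->
  meas_row d (fun x => f (x *m A)).
Proof.
move=> mf; rewrite (_ : (fun _ => _) = fun x => f (x *m A + 0)).
  exact: meas_row_affine.
by apply/funext => x; rewrite addr0.
Qed.

Lemma scales_integral_mul d A B :
  scales_integral d A -> scales_integral d B -> scales_integral d (A *m B).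
Proof.
move=> [a a0 hA] [b b0 hB]; exists (a * b); first exact: mulr_gt0.
move=> f mf f0; rewrite EFinM -muleA -hB// -(hA (fun x => f (x *m B)))//.
  by apply: eq_int_row => x; rewrite mulmxA.
exact: meas_row_linear.
Qed.

(** Such a matrix acts on row vectors by changing coordinate [j] alone, so it is a [change_coord]
    with a linear [l]. *)
Lemma scales_integral_column d (j : 'I_d) (C : 'M[R]_d) : C j j != 0 ->
  (forall i k, k != j -> C i k = (i == k)%:R) -> scales_integral d C.
Proof.
case: d => [|n] in j C *; first by case: j.
move=> Cjj Cid; exists (`|C j j|^-1); first by rewrite invr_gt0 normr_gt0.
move=> f mf f0.
pose l (s : seq R) := \sum_(i < n) nth 0 s i * C (lift j i) j.
rewrite !int_rowE -(iint_change_coord _ n j (C j j) l _ (ltn_ord j))//; last 3 first.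
- by move=> s; rewrite lee_fin.
- exact: meas_row_seq.
- apply: measurable_sum => i; apply: measurable_funM => //.
  exact: measurable_nth_tuple.
apply: eq_iint => s sn /=; congr ((f _)%:E); apply/rowP => k; rewrite !mxE.
have js : (j < size s)%N by rewrite sn.
rewrite /change_coord nth_insert ?size_delete ?sn//; last by rewrite -ltnS.
have [->|kj] := eqVneq k j.
  rewrite ltnn eqxx (bigD1_ord j)//= mxE mulrC; congr +%R.
  by apply: eq_bigr => i _; rewrite nth_delete// mxE /= /bump ltnNge; case: leqP.
rewrite (bigD1 k)//= big1 => [|i ik]; last by rewrite Cid// (negbTE ik) mulr0.
rewrite Cid// eqxx mulr1 addr0 mxE.
have {}kj : (k : nat) != j by [].
rewrite !nth_delete//; case: ltnP => // jk; rewrite (negbTE kj).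
have lt : (j < k)%N by rewrite ltn_neqAle eq_sym kj.
case: (k : nat) lt kj => // k' jk' _ /=.
by rewrite ltnNge -ltnS jk'.
Qed.

(* Gaussian elimination by one-column matrices: the columns are turned into unit
   vectors starting from the last one. Column [j] can be cleared when the diagonal
   entry [j] of the inverse is nonzero, which a shear involving an earlier column
   achieves. *)
Lemma scales_integral_unit d (A : 'M[R]_d) : A \in unitmx -> scales_integral d A.
Proof.
have step k (j : 'I_d) : j = k :> nat ->
    (forall A : 'M[R]_d, A \in unitmx ->
      (forall i s : 'I_d, (k <= s)%N -> A i s = (i == s)%:R) -> scales_integral d A) ->
    forall A B : 'M[R]_d, A *m B = 1%:M ->
      (forall i s : 'I_d, (k.+1 <= s)%N -> A i s = (i == s)%:R) -> B j j != 0 ->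
      scales_integral d A.
  move=> jk IH {}A B AB Aid Bjj.
  pose A' : 'M[R]_d := \matrix_(r, s) if s == j then (r == s)%:R else A r s.
  (* Column [j] of [A *m B = 1] expresses the unit vector [e_j] through the columns of [A]. Solving
     for column [j] of [A] gives these coefficients, with [e_j] as column [j] of [A']; the division
     explains the condition on [B j j]. *)
  pose C : 'M[R]_d := \matrix_(r, s) if s == j then
    (if r == j then (B j j)^-1 else - B r j / B j j) else (r == s)%:R.
  have AE : A = A' *m C.
    apply/matrixP => r s; rewrite mxE; have [->{s}|sj] := eqVneq s j.
      move/matrixP/(_ r j): AB; rewrite !mxE (bigD1 j)//= => AB.
      rewrite (bigD1 j)//= !mxE !eqxx -AB mulrDl mulfK//.
      rewrite -addrA [X in _ + X](_ : _ = 0) ?addr0//.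
      rewrite mulr_suml -big_split big1//= => i ij.
      by rewrite !mxE eqxx (negbTE ij); ring.
    rewrite (bigD1 s)//= !mxE (negbTE sj) eqxx mulr1 big1 ?addr0// => i ne.
    by rewrite !mxE (negbTE sj) (negbTE ne) mulr0.
  have : A \in unitmx by case: (mulmx1_unit AB).
  rewrite AE unitmx_mul => /andP[A'u Cu].
  apply: scales_integral_mul.
    apply: IH => // i s ks; rewrite mxE; case: eqVneq => // sj.
    by apply: Aid; rewrite ltn_neqAle ks -jk eq_sym sj.
  apply: (scales_integral_column _ j); first by rewrite mxE !eqxx invr_eq0.
  by move=> i s sj; rewrite mxE (negbTE sj).
suff main k : (k <= d)%N -> forall A : 'M[R]_d, A \in unitmx ->
    (forall i s : 'I_d, (k <= s)%N -> A i s = (i == s)%:R) -> scales_integral d A.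
  by move=> Au; apply: (main d) => // i s; rewrite leqNgt ltn_ord.
elim: k => [_|k IH kd] {}A Au Aid.
  rewrite (_ : A = 1%:M); first exact: scales_integral1.
  by apply/matrixP => i s; rewrite Aid// mxE.
pose j := Ordinal kd; have AB := mulmxV Au; set B := invmx A in AB.
have IH' := IH (ltnW kd).
have [Bjj|] := eqVneq (B j j) 0; last exact: (step k j _ IH' A B AB).
(* Entry [(j, j)] of [A *m B] is 1. From index [k] on, row [j] of [A] is that of the identity and
   contributes only [B j j = 0], so an earlier index must contribute. *)
have [i ik Bij] : exists2 i : 'I_d, (i < k)%N & B i j != 0.
  apply: contrapT => nex; have /matrixP/(_ j j) := AB; rewrite !mxE eqxx big1.
    by move/eqP; rewrite eq_sym oner_eq0.
  move=> i _; have [ik|ki] := ltnP i k.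
    have [->|Bij] := eqVneq (B i j) 0; first by rewrite mulr0.
    by case: nex; exists i.
  have [->|ij] := eqVneq i j; first by rewrite Bjj mulr0.
  rewrite Aid ?mul0r// 1?eq_sym ?(negbTE ij) ?mul0r//.
  by rewrite ltn_neqAle ki andbT eq_sym.
have ij : i != j by rewrite -val_eqE /= ltn_eqF.
(* The shears [1 - D] and [1 + D] are inverse to each other. The inverse of [A *m (1 - D)] is
   [(1 + D) *m B], whose entry [(j, j)] is [B j j + B i j = B i j], a valid pivot. *)
pose D : 'M[R]_d := delta_mx j i.
have DD : D *m D = 0 by rewrite mul_delta_mx_0.
have DN : (1%:M - D) *m (1%:M + D) = 1%:M.
  by rewrite mulmxDr mulmx1 mulmxBl mul1mx DD subr0 subrK.
rewrite -[A]mulmx1 -DN mulmxA; apply: scales_integral_mul.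
  apply: (step k j _ IH' _ ((1%:M + D) *m B)) => //.
  - by rewrite -mulmxA (mulmxA _ _ B) DN mul1mx.
  - move=> r s ks; rewrite mulmxBr mulmx1 mxE Aid// [X in _ + X]mxE.
    rewrite mxE big1 ?subr0// => t _; rewrite mxE.
    have /negbTE -> : s != i by rewrite -val_eqE gtn_eqF// (ltn_trans ik).
    by rewrite andbF mulr0.
  - rewrite mulmxDl mul1mx mxE Bjj add0r mxE (bigD1 i)//= big1 => [|t ti].
      by rewrite mxE !eqxx mul1r addr0.
    by rewrite mxE (negbTE ti) andbF mul0r.
apply: (scales_integral_column _ i).
  by rewrite !mxE eqxx (negbTE ij) addr0 oner_eq0.
by move=> r s si; rewrite !mxE (negbTE si) andbF addr0.
Qed.

Lemma int_row_affine d (A : 'M[R]_d) (b : 'rV[R]_d) : A \in unitmx ->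
  exists2 c : R, 0 < c & forall f, meas_row d f -> (forall x, 0 <= f x) ->
    (int_row d (fun x => f (x *m A + b)%R) = c%:E * int_row d f)%E.
Proof.
move=> /scales_integral_unit [c c0 cA]; exists c => // f mf f0.
rewrite (cA (fun x => f (x + b)))//; first by rewrite int_row_translate.
rewrite (_ : (fun _ => _) = fun x => f (x *m 1%:M + b)).
  exact: meas_row_affine.
by apply/funext => x; rewrite mulmx1.
Qed.

End RowIntegral.

(** * Null sets and hyperplanes *)

Section NullSets.
Variable R : realType.
Notation RT := (measurableTypeR R).

Definition meas_pred d (P : 'rV[R]_d -> bool) :=
  measurable_fun [set: d.-tuple RT] (fun t => P (row_of_seq R d t)).

Lemma meas_row_pred d P : meas_pred d P -> meas_row R d (fun x => (P x)%:R).
Proof.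
move=> mP; rewrite /meas_row (_ : (fun _ => _) =
  fun t : d.-tuple RT => if P (row_of_seq R d t) then 1 else 0 : RT).
  exact: measurable_fun_ifT.
by apply/funext => t; case: (P _).
Qed.

Lemma meas_pred_le d f g : meas_row R d f -> meas_row R d g ->
  meas_pred d (fun x => f x <= g x).
Proof. by move=> mf mg; exact: measurable_fun_ler. Qed.

Lemma meas_pred_eq d f g : meas_row R d f -> meas_row R d g ->
  meas_pred d (fun x => f x == g x).
Proof. by move=> mf mg; exact: measurable_fun_eqr. Qed.

Lemma meas_pred_and d P Q : meas_pred d P -> meas_pred d Q ->
  meas_pred d (fun x => P x && Q x).
Proof. by move=> mP mQ; exact: measurable_and. Qed.

Lemma meas_pred_cst d b : meas_pred d (fun=> b).
Proof. exact: measurable_cst. Qed.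

Lemma meas_pred_forall d (I : finType) (P : I -> 'rV[R]_d -> bool) :
  (forall i, meas_pred d (P i)) -> meas_pred d (fun x => [forall i, P i x]).
Proof.
move=> mP; rewrite /meas_pred (_ : (fun _ => _) =
  fun t : d.-tuple RT => all (fun i => P i (row_of_seq R d t)) (enum I)); last first.
  apply/funext => t; apply/forallP/allP => [h i _|h i]; first exact: h.
  by apply: h; rewrite mem_enum.
elim: (enum I) => [|i r IH] /=; first exact: measurable_cst.
by apply: measurable_and => //; exact: mP.
Qed.

Lemma meas_pred_exists d (I : finType) (P : I -> 'rV[R]_d -> bool) :
  (forall i, meas_pred d (P i)) -> meas_pred d (fun x => [exists i, P i x]).
Proof.
move=> mP; rewrite /meas_pred (_ : (fun _ => _) =
  fun t : d.-tuple RT => has (fun i => P i (row_of_seq R d t)) (enum I)); last first.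
  apply/funext => t; apply/existsP/hasP => [[i h]|[i _ h]]; exists i => //.
  by rewrite mem_enum.
elim: (enum I) => [|i r IH] /=; first exact: measurable_cst.
by apply: measurable_or => //; exact: mP.
Qed.

Definition null_pred d (P : 'rV[R]_d -> bool) :=
  meas_pred d P /\ int_row R d (fun x => (P x)%:R) = 0%E.

Lemma null_exists d (I : finType) (P : I -> 'rV[R]_d -> bool) :
  (forall i, null_pred d (P i)) -> null_pred d (fun x => [exists i, P i x]).
Proof.
move=> nP; split; first by apply: meas_pred_exists => i; case: (nP i).
apply/eqP; rewrite eq_le int_row_ge0 ?andbT//.
apply: (@le_trans _ _ (int_row R d (fun x => \sum_i (P i x)%:R))).
  apply: le_int_row => x; first exact: ler0n.
  case: existsP => [[i Pi]|_]; last by apply: sumr_ge0 => i _; exact: ler0n.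
  by rewrite (bigD1 i)//= Pi lerDl; apply: sumr_ge0 => j _; exact: ler0n.
rewrite int_row_sum => [|i x|i]; last 2 first.
- exact: ler0n.
- by apply: meas_row_pred; case: (nP i).
by rewrite big1// => i _; case: (nP i).
Qed.

(** The exceptional set enters as an additive penalty of integral 0, so [f] only has to be
    controlled by a bound there. *)
Lemma le_int_row_ae d (f g : 'rV[R]_d -> R) P C : null_pred d P -> 0 <= C ->
  (forall x, 0 <= f x) -> (forall x, 0 <= g x) -> meas_row R d g ->
  (forall x, f x <= g x + C * (P x)%:R) -> (int_row R d f <= int_row R d g)%E.
Proof.
move=> [mP nP] C0 f0 g0 mg fg; have mP' := meas_row_pred _ _ mP.
apply: le_trans (le_int_row _ _ _ _ f0 fg) _.
rewrite int_rowD//; last 2 first.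
- by move=> x; rewrite mulr_ge0.
- by apply: meas_rowM => //; exact: measurable_cst.
by rewrite int_rowZ// nP mule0 adde0.
Qed.

(** A linear map that changes one coordinate [j] with [a j] nonzero turns the linear form into that
    coordinate. The hyperplane becomes [y_j = - b], a single point for the integral in [y_j]. *)
Lemma null_hyperplane d (a : 'cV[R]_d) (b : R) : a != 0 ->
  null_pred d (fun x => (x *m a) 0 0 + b == 0).
Proof.
move=> /cV0Pn; case: d a => [|n] a [j aj]; first by case: (j).
have mP m (u : 'cV[R]_m) : meas_pred m (fun x => (x *m u) 0 0 + b == 0).
  apply: meas_pred_eq; last exact: measurable_cst.
  apply: measurable_funD; last exact: measurable_cst.
  rewrite (_ : (fun _ => _) = fun t : m.-tuple RT =>
      (fun y : 'rV_1 => y 0 0) (row_of_seq R m t *m u + 0)).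
    by apply: (meas_row_affine _ _ _ u 0 (fun y => y 0 0)); exact: meas_row_coord.
  by apply/funext => t; rewrite addr0.
split; first exact: mP.
pose C : 'M[R]_n.+1 := \matrix_(i, k) if k == j then a i 0 else (i == k)%:R.
have [c c0 cC] : scales_integral R n.+1 C.
  apply: (scales_integral_column _ _ j); first by rewrite mxE eqxx.
  by move=> i k kj; rewrite mxE (negbTE kj).
pose f (y : 'rV[R]_n.+1) := ((y *m (delta_mx j 0 : 'cV_n.+1)) 0 0 + b == 0)%:R : R.
have mf : meas_row R n.+1 f by apply: meas_row_pred; exact: mP.
rewrite (eq_int_row _ _ _ (fun x => f (x *m C))); last first.
  move=> x; rewrite /f; congr ((_ + _ == _)%:R).
  rewrite -mulmxA; congr ((_ *m _) 0 0); apply/colP => i.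
  by rewrite -colE !mxE eqxx.
rewrite cC//.
rewrite [X in (_ * X)%E](_ : _ = 0%E) ?mule0//.
rewrite int_rowE (iint_insert _ _ _ j)//; last 3 first.
- by rewrite -ltnS.
- by move=> s; rewrite lee_fin ler0n.
- exact: meas_row_seq.
have jn : (j <= n)%N by rewrite -ltnS.
pose h (t : R) : \bar R := ((t + b == 0)%:R)%:E.
transitivity (\int[@lebesgue_measure R]_t iint n (fun s => h t * 1))%E.
  apply: eq_integral => t _; apply: eq_iint => s sn; rewrite mule1 /h /f.
  congr ((_ + _ == _)%:R%:E); rewrite -colE mxE mxE nth_insert ?sn//.
  by rewrite ltnn eqxx.
have mh : measurable_fun [set: RT] h.
  apply/measurable_EFinP; rewrite (_ : (fun _ => _) =
    fun t : RT => if t + b == 0 then 1 else 0 : RT).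
    apply: measurable_fun_ifT => //; apply: measurable_fun_eqr => //.
    exact: measurable_funD.
  by apply/funext => t; case: eqP.
rewrite (integral_iint _ _ (fun t s => h t * 1)%E); last 2 first.
- by move=> t s; rewrite mule1 lee_fin ler0n.
- rewrite (_ : (fun _ => _) = h \o fst); first exact: measurableT_comp.
  by apply/funext => p; rewrite mule1.
transitivity (iint n (fun s : seq R => 0 * 0 : \bar R)%E).
  apply: eq_iint => s _; rewrite mule0.
  transitivity (\int[@lebesgue_measure R]_t (\1_[set - b]%classic t)%:E)%E.
    apply: eq_integral => t _; rewrite mule1 /h indicE; congr (_%:R%:E).
    congr nat_of_bool; apply/idP/idP; first by rewrite addr_eq0 inE => /eqP.
    by rewrite inE => /= ->; rewrite addNr.
  by rewrite integral_indic// setIT; exact: lebesgue_measure_set1.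
by rewrite iintZ ?mul0e//; exact: measurable_cst.
Qed.

End NullSets.

(** * Barycentric coordinates *)

(* The [nondegenerate] of sesquilinear forms shadows the one of [Defs]. *)
Local Notation nondeg := Defs.nondegenerate.

Section Barycentric.
Variables (R : realType) (d : nat).
Implicit Types (v w : 'I_d.+1 -> Rpoint R d) (g f : 'rV[R]_d.+1 -> R).

Lemma bary_unique v (x : 'rV[R]_d) (l : 'rV[R]_d.+1) : nondeg v ->
  l *m simplex_mx v = row_mx 1 x -> bary v x = l.
Proof. by move=> nv lE; rewrite /bary -lE mulmxK. Qed.

Lemma bary_mul v (x : 'rV[R]_d) : nondeg v ->
  bary v x *m simplex_mx v = row_mx 1 x.
Proof. by move=> nv; rewrite /bary mulmxKV. Qed.

Lemma lsubmx_simplex v : @lsubmx R d.+1 1 d (simplex_mx v) = const_mx 1.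
Proof. by rewrite /simplex_mx row_mxKl. Qed.

Lemma bary_sum v x : nondeg v -> \sum_i bary v x 0 i = 1.
Proof.
move=> nv; have /(congr1 (@lsubmx R 1 1 d)) := bary_mul v x nv.
rewrite row_mxKl -mulmx_lsub lsubmx_simplex => /matrixP/(_ 0 0).
rewrite !mxE => E; rewrite -[RHS]E; apply: eq_bigr => i _.
by rewrite [const_mx 1 i 0]mxE mulr1.
Qed.

Definition int_bary v g : \bar R := int_row R d (fun x => g (bary v x)).

Lemma row_mx1_mul m (M : 'M[R]_(1 + d, m)) (x : 'rV[R]_d) :
  row_mx 1 x *m M = x *m dsubmx M + usubmx M.
Proof. by rewrite -[in LHS](vsubmxK M) mul_row_col mul1mx addrC. Qed.

(** The row dimension is written [1 + d] so that the matrix splits into its constant row and its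
    linear part. *)
Definition bary_mx v : 'M[R]_(1 + d, d.+1) := invmx (simplex_mx v).

Lemma bary_affine v x : bary v x = x *m dsubmx (bary_mx v) + usubmx (bary_mx v).
Proof. exact: (row_mx1_mul d.+1 (bary_mx v) x). Qed.

Lemma meas_row_bary v g : meas_row R d.+1 g -> meas_row R d (fun x => g (bary v x)).
Proof.
move=> mg; rewrite (_ : (fun _ => _) = fun x => g
  (x *m dsubmx (bary_mx v) + usubmx (bary_mx v))); first exact: meas_row_affine.
by apply/funext => x; rewrite bary_affine.
Qed.

Lemma lsubmx1 : lsubmx (1%:M : 'M[R]_(1 + d)) = col_mx 1%:M 0.
Proof. by rewrite scalar_mx_block block_mxEh row_mxKl. Qed.

(** [N] sends [[1 | x]] to [[1 | x A + b]]: its first column is a unit vector because both simplex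
    matrices begin with a column of ones. Hence [bary w x = bary v (x A + b)], and one factor serves
    every [g]. *)
Lemma int_bary_change v w : nondeg v -> nondeg w ->
  exists2 c : R, 0 < c & forall g, meas_row R d.+1 g -> (forall l, 0 <= g l) ->
    (int_bary w g = c%:E * int_bary v g)%E.
Proof.
move=> nv nw.
pose N : 'M[R]_(1 + d) := invmx (simplex_mx w) *m simplex_mx v.
have Nl : lsubmx N = col_mx 1%:M 0.
  rewrite /N -mulmx_lsub lsubmx_simplex -(lsubmx_simplex w) mulmx_lsub.
  by rewrite mulVmx//; exact: lsubmx1.
pose A := drsubmx N; pose b := ursubmx N.
have NE : N = block_mx 1%:M b 0 A.
  rewrite -[LHS]submxK; congr block_mx; apply/matrixP => i j.
    have /matrixP/(_ (lshift d i) j) := Nl; rewrite col_mxEu => <-.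
    by rewrite !mxE; do 2 congr (_ _ _); rewrite !ord1.
  have /matrixP/(_ (rshift 1 i) j) := Nl; rewrite col_mxEd => <-.
  by rewrite !mxE.
have Nu : N \in unitmx.
  by rewrite unitmx_mul unitmx_inv; apply/andP.
have Au : A \in unitmx.
  by move: Nu; rewrite !unitmxE NE det_ublock det1 mul1r.
have baryE x : bary w x = bary v (x *m A + b).
  apply/esym/(bary_unique v) => //.
  transitivity ((row_mx 1 x : 'rV_(1 + d)) *m N); last first.
    by rewrite NE mul_row_block mulmx1 mulmx0 addr0 mul1mx addrC.
  by rewrite /N /bary mulmxA.
have [c c0 cA] := int_row_affine R d A b Au; exists c => // g mg g0.
rewrite -cA//; last exact: meas_row_bary.
by apply: eq_int_row => x; rewrite baryE.
Qed.

(** Barycentric coordinates sum to 1, so a form with constant coefficients is constant in [x].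
    Conversely, if the linear part in [x] vanishes, multiplying back by the simplex matrix shows
    that [u] is constant. Otherwise the zero set is a hyperplane. *)
Lemma null_bary v (P : 'rV[R]_d.+1 -> bool) (u : 'cV[R]_d.+1) : nondeg v ->
  (forall l, P l = ((l *m u) 0 0 == 0)) -> (exists i j, u i 0 != u j 0) ->
  null_pred R d (fun x => P (bary v x)).
Proof.
move=> nv PE [i [j uij]].
pose M := bary_mx v.
rewrite (_ : (fun _ => _) =
  fun x => (x *m (dsubmx M *m u)) 0 0 + (usubmx M *m u) 0 0 == 0); last first.
  by apply/funext => x; rewrite PE bary_affine mulmxDl mulmxA mxE.
apply: null_hyperplane; apply: contraNneq uij => Mu0.
pose k := (usubmx M *m u) 0 0.
have MuE : M *m u = col_mx (const_mx k) (0 : 'cV_d).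
  rewrite -[in LHS](vsubmxK M) mul_col_mx Mu0; congr col_mx.
  by apply/matrixP => a b; rewrite !ord1 [RHS]mxE.
have uE : u = const_mx k.
  rewrite -[LHS](mulKVmx nv) -/M MuE /simplex_mx.
  rewrite (mul_row_col (const_mx 1 : 'cV_d.+1)) mulmx0 addr0.
  by apply/matrixP => a b; rewrite !mxE big_ord1 !mxE mul1r.
by rewrite uE !mxE.
Qed.

Definition ties (l : 'rV[R]_d.+1) :=
  [exists i, exists j, (i != j) && (l 0 i == l 0 j)].

Lemma null_ties v : nondeg v -> null_pred R d (fun x => ties (bary v x)).
Proof.
move=> nv; apply: null_exists => i; apply: null_exists => j.
have [->|ij] := eqVneq i j.
  by split; [exact: measurable_cst | exact: int_row0].
apply: (null_bary _ (fun l => true && (l 0 i == l 0 j))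
  (delta_mx i 0 - delta_mx j 0)) => //.
  by move=> l; rewrite mulmxBr -!colE !mxE subr_eq0.
exists i, j; rewrite !mxE !eqxx [j == i]eq_sym (negbTE ij) /=.
by apply/eqP => E; lra.
Qed.

Lemma null_face v i : nondeg v -> (0 < d)%N ->
  null_pred R d (fun x => bary v x 0 i == 0).
Proof.
move=> nv d0; apply: (null_bary _ (fun l => l 0 i == 0) (delta_mx i 0)) => //.
  by move=> l; rewrite -colE mxE.
have [j ij] : exists j : 'I_d.+1, j != i.
  have [->|i0] := eqVneq i ord0; last by exists ord0; rewrite eq_sym.
  by exists (Ordinal (d0 : 1 < d.+1)%N).
by exists i, j; rewrite !mxE eqxx (negbTE ij) oner_eq0.
Qed.

Lemma bary_perm v (s : {perm 'I_d.+1}) x : nondeg v ->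
  nondeg (v \o s) /\ bary (v \o s) x = col_perm s (bary v x).
Proof.
move=> nv.
have E : simplex_mx (v \o s) = row_perm s (simplex_mx v).
  apply/matrixP => i j; rewrite !mxE; case: splitP => k _; by rewrite !mxE.
have ns : nondeg (v \o s).
  by rewrite /nondeg E row_permE unitmx_mul unitmx_perm.
split=> //; apply: bary_unique => //.
by rewrite E col_permE row_permE mulmxA -(mulmxA _ _ (perm_mx s)) -perm_mxM mulVg
  perm_mx1 mulmx1 bary_mul.
Qed.

End Barycentric.

(** * Integrals over a simplex in barycentric coordinates *)

Section SimplexIntegral.
Variables (R : realType) (d : nat).
Implicit Types (v w : 'I_d.+1 -> Rpoint R d) (g f : 'rV[R]_d.+1 -> R).

(** On barycentric coordinates, whose sum is 1, this describes the closed simplex ([in_coneE]). The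
    upper bound keeps coordinates bounded also for vectors [l] of another sum. *)
Definition in_cone (l : 'rV[R]_d.+1) := [forall i, 0 <= l 0 i <= 1].

Lemma meas_in_cone : meas_pred R d.+1 in_cone.
Proof.
apply: meas_pred_forall => i; apply: meas_pred_and; apply: meas_pred_le;
  by [exact: meas_row_coord | exact: measurable_cst].
Qed.

(** The simplex matrix of the origin and the unit vectors. *)
Definition ref_mx : 'M[R]_(1 + d) := block_mx 1%:M 0 (const_mx 1) 1%:M.
Definition ref_simplex (i : 'I_d.+1) : Rpoint R d := row i (rsubmx ref_mx).

Lemma simplex_mx_ref : simplex_mx ref_simplex = ref_mx.
Proof.
transitivity (row_mx (lsubmx ref_mx) (rsubmx ref_mx)); last first.
  exact (@hsubmxK R (1 + d) 1 d ref_mx).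
apply: (f_equal2 (@row_mx R d.+1 1 d)).
  rewrite /ref_mx block_mxEh row_mxKl -[LHS](@vsubmxK _ 1 d); apply: f_equal2.
    by apply/matrixP => i j; rewrite !mxE !ord1.
  by apply/matrixP => i j; rewrite !mxE.
by apply/matrixP => i j; rewrite !mxE.
Qed.

Lemma nondeg_ref : nondeg ref_simplex.
Proof.
rewrite /Defs.nondegenerate simplex_mx_ref unitmxE (@det_lblock R 1 d).
by rewrite !det1 mul1r unitr1.
Qed.

Lemma bary_ref (x : 'rV[R]_d) :
  bary ref_simplex x = row_mx (1%:M - x *m const_mx 1) x.
Proof.
apply: bary_unique; first exact: nondeg_ref.
rewrite simplex_mx_ref.
have E : row_mx (1%:M - x *m const_mx 1) x *m ref_mx = row_mx 1%:M x.
  by rewrite mul_row_block !mulmx1 mulmx0 add0r subrK.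
exact: E.
Qed.

Lemma in_cone_ref (x : 'rV[R]_d) : in_cone (bary ref_simplex x) =
  [forall i, 0 <= x 0 i] && (\sum_i x 0 i <= 1).
Proof.
have sE : (x *m (const_mx 1 : 'cV_d)) 0 0 = \sum_i x 0 i.
  by rewrite mxE; apply: eq_bigr => i _; rewrite mxE mulr1.
have hr i : bary ref_simplex x 0 (rshift 1 i) = x 0 i.
  by rewrite bary_ref; exact: row_mxEr.
have hl (i : 'I_1) : bary ref_simplex x 0 (lshift d i) = 1 - \sum_i x 0 i.
  rewrite bary_ref; transitivity ((1%:M - x *m const_mx 1 : 'M[R]_1) 0 i).
    exact: row_mxEl.
  by rewrite mxE [X in _ + X]mxE !ord1 sE mxE eqxx.
apply/forallP/andP => [h|[/forallP h1 h2] i].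
  split; first by apply/forallP => i; rewrite -hr; case/andP: (h (rshift 1 i)).
  by rewrite -subr_ge0 -(hl ord0); case/andP: (h (lshift d (ord0 : 'I_1))).
have [j ->|j ->] := split_ordP (i : 'I_(1 + d)).
  by rewrite hl subr_ge0 h2 gerBl sumr_ge0.
by rewrite hr h1 (le_trans _ h2)// (bigD1 j)//= lerDl sumr_ge0.
Qed.

(** The reference simplex lies in the unit cube and contains the box of side 1 / (d + 1), since d /
    (d + 1) is at most 1. Its volume is thus finite and positive. *)
Lemma int_cone_ref : exists2 c : R, 0 < c &
  int_bary R d ref_simplex (fun l => (in_cone l)%:R) = c%:E.
Proof.
pose I := int_bary R d ref_simplex (fun l => (in_cone l)%:R).
have a0 : 0 < (d.+1%:R^-1 : R) by rewrite invr_gt0 ltr0Sn.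
have lb : ((d.+1%:R^-1 ^+ d)%:E <= I)%E.
  rewrite -(iint_box R d _ (ltW a0)); apply: le_iint => s.
    by rewrite lee_fin ler0n.
  move=> sd; rewrite lee_fin in_cone_ref.
  case: (boolP (all _ s)) => [/all_nthP h|_]; last exact: ler0n.
  have h' i : (0 <= row_of_seq R d s 0 i <= d.+1%:R^-1).
    by rewrite mxE; apply: h; rewrite sd.
  rewrite (_ : _ && _ = true)//; apply/andP; split.
    by apply/forallP => i; case/andP: (h' i).
  apply: (@le_trans _ _ (\sum_(i < d) d.+1%:R^-1)).
    by apply: ler_sum => i _; case/andP: (h' i).
  rewrite sumr_const card_ord -[leLHS]mulr_natl ler_pdivrMr ?ltr0Sn// mul1r ler_nat.
  exact: leqnSn.
have ub : (I <= 1%:E)%E.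
  rewrite -(expr1n R d) -(iint_box R d _ ler01); apply: le_iint => s.
    by rewrite lee_fin ler0n.
  move=> sd; rewrite lee_fin in_cone_ref.
  case: andP => [[/forallP h1 h2]|_]; last exact: ler0n.
  rewrite (_ : all _ _ = true)//; apply/(all_nthP 0) => i; rewrite sd => id.
  have := h1 (Ordinal id); rewrite mxE /= => -> /=; apply: le_trans h2.
  rewrite (bigD1 (Ordinal id))//= mxE lerDl; exact: sumr_ge0.
have If : I \is a fin_num.
  rewrite fin_numElt (lt_le_trans _ lb) ?ltNyr//=.
  by rewrite (le_lt_trans ub) ?ltry.
exists (fine I); last by rewrite fineK.
rewrite -lte_fin fineK//; apply: lt_le_trans lb.
by rewrite lte_fin exprn_gt0.
Qed.

Lemma int_cone v : nondeg v -> exists2 c : R, 0 < c &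
  int_bary R d v (fun l => (in_cone l)%:R) = c%:E.
Proof.
move=> nv; have [a a0 aE] := int_cone_ref.
have [c c0 cE] := int_bary_change R d _ _ nondeg_ref nv.
exists (c * a); first exact: mulr_gt0.
by rewrite cE// ?aE//; apply: meas_row_pred; exact: meas_in_cone.
Qed.

(** Such integrands have a finite integral over every nondegenerate simplex, so nothing is lost when
    [rint] passes to real numbers through [fine]. *)
Definition cone_supp g := meas_row R d.+1 g /\
  exists C, forall l, 0 <= g l <= C * (in_cone l)%:R.

Lemma cone_supp_ge0 g l : cone_supp g -> 0 <= g l.
Proof. by case=> _ [C /(_ l) /andP[]]. Qed.

Lemma cone_supp_ub g : cone_supp g -> exists2 C, 0 <= C & forall l, g l <= C.
Proof.
case=> _ [C gC]; exists `|C| => // l; case/andP: (gC l) => _ /le_trans; apply.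
by case: (in_cone l); rewrite ?mulr1 ?mulr0 ?ler_norm.
Qed.

Lemma cone_suppD f g : cone_supp f -> cone_supp g -> cone_supp (fun l => f l + g l).
Proof.
move=> [mf [C fC]] [mg [D gD]]; split; first exact: measurable_funD.
exists (C + D) => l; case/andP: (fC l) => f0 fl; case/andP: (gD l) => g0 gl.
by rewrite addr_ge0//= mulrDl lerD.
Qed.

Lemma cone_suppZ k g : 0 <= k -> cone_supp g -> cone_supp (fun l => k * g l).
Proof.
move=> k0 [mg [C gC]]; split; first by apply: measurable_funM.
exists (k * C) => l; case/andP: (gC l) => g0 gl.
by rewrite mulr_ge0//= -mulrA ler_wpM2l.
Qed.

Lemma cone_supp0 : cone_supp (fun=> 0).
Proof.
split; first exact: measurable_cst.
by exists 0 => l; rewrite mul0r lexx.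
Qed.

Lemma cone_supp_sum (I : Type) (r : seq I) (P : pred I) F :
  (forall i, P i -> cone_supp (F i)) ->
  cone_supp (fun l => \sum_(i <- r | P i) F i l).
Proof.
move=> F0; elim: r => [|i r IH].
  under [X in cone_supp X]funext do rewrite big_nil; exact: cone_supp0.
under [X in cone_supp X]funext do rewrite big_cons.
by case Pi: (P i) => //; apply: cone_suppD => //; exact: F0.
Qed.

Lemma cone_supp_pred (P : 'rV[R]_d.+1 -> bool) h : meas_pred R d.+1 P ->
  meas_row R d.+1 h ->
  (exists C, forall l, P l -> in_cone l /\ 0 <= h l <= C) ->
  cone_supp (fun l => (P l)%:R * h l).
Proof.
move=> mP mh [C hC]; split; first by apply: meas_rowM => //; exact: meas_row_pred.
exists `|C| => l; have := hC l; case: (P l) => [/(_ isT) [-> /andP[h0 hl]]|_].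
  by rewrite mul1r mulr1 h0 (le_trans hl)// ler_norm.
by rewrite mul0r lexx mulr_ge0.
Qed.

Definition rint v g := fine (int_bary R d v g).

Lemma rintE v g : nondeg v -> cone_supp g -> int_bary R d v g = (rint v g)%:E.
Proof.
move=> nv ag; have g0 l := cone_supp_ge0 _ l ag.
rewrite /rint fineK//; have [c c0 cE] := int_cone v nv.
case: ag => mg [C gC].
rewrite ge0_fin_numE; last by apply: int_row_ge0 => x; exact: g0.
apply: (@le_lt_trans _ _ (`|C| * c)%:E); last exact: ltry.
rewrite EFinM -cE /int_bary -int_rowZ//; last first.
  exact: (meas_row_bary _ _ _ _ (meas_row_pred _ _ _ meas_in_cone)).
apply: le_int_row => // x; case/andP: (gC (bary v x)) => _ /le_trans; apply.
by rewrite ler_wpM2r// ler_norm.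
Qed.

Lemma eq_rint v f g : nondeg v -> (forall x, f (bary v x) = g (bary v x)) ->
  rint v f = rint v g.
Proof. by move=> nv fg; congr fine; apply: eq_int_row. Qed.

Lemma rintD v f g : nondeg v -> cone_supp f -> cone_supp g ->
  rint v (fun l => f l + g l) = rint v f + rint v g.
Proof.
move=> nv af ag; apply: EFin_inj; rewrite EFinD -!rintE//; last exact: cone_suppD.
rewrite /int_bary int_rowD//.
- by move=> x; exact: cone_supp_ge0.
- by move=> x; exact: cone_supp_ge0.
- by apply: meas_row_bary; case: af.
- by apply: meas_row_bary; case: ag.
Qed.

Lemma rintZ v k g : nondeg v -> 0 <= k -> cone_supp g ->
  rint v (fun l => k * g l) = k * rint v g.
Proof.
move=> nv k0 ag; apply: EFin_inj; rewrite EFinM -!rintE//; last exact: cone_suppZ.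
rewrite /int_bary int_rowZ//.
- by move=> x; exact: cone_supp_ge0.
- by apply: meas_row_bary; case: ag.
Qed.

Lemma rint_sum v (I : Type) (r : seq I) (P : pred I) F : nondeg v ->
  (forall i, P i -> cone_supp (F i)) ->
  rint v (fun l => \sum_(i <- r | P i) F i l) = \sum_(i <- r | P i) rint v (F i).
Proof.
move=> nv aF; elim: r => [|i r IH].
  rewrite big_nil -[RHS](mul0r (rint v (fun=> 0))) -rintZ//; last exact: cone_supp0.
  by apply: eq_rint => // x; rewrite big_nil mul0r.
rewrite big_cons -IH; case Pi: (P i); last first.
  by apply: eq_rint => // x; rewrite big_cons Pi.
rewrite -rintD//; [|exact: aF|exact: cone_supp_sum].
by apply: eq_rint => // x; rewrite big_cons Pi.
Qed.

Lemma rint_change v w : nondeg v -> nondeg w -> exists2 c : R, 0 < c &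
  forall g, cone_supp g -> rint w g = c * rint v g.
Proof.
move=> nv nw; have [c c0 cE] := int_bary_change R d _ _ nv nw.
exists c => // g ag; apply: EFin_inj; rewrite EFinM -!rintE// cE//.
- by case: ag.
- by move=> l; exact: cone_supp_ge0.
Qed.

Lemma rint_cone_gt0 v : nondeg v -> 0 < rint v (fun l => (in_cone l)%:R).
Proof. by move=> nv; have [c c0 cE] := int_cone v nv; rewrite /rint cE. Qed.

Lemma cone_supp_cone : cone_supp (fun l => (in_cone l)%:R).
Proof.
split; first by apply: meas_row_pred; exact: meas_in_cone.
by exists 1 => l; rewrite mul1r ler0n lexx.
Qed.

Lemma in_coneE v x : nondeg v ->
  in_cone (bary v x) = [forall i, 0 <= bary v x 0 i].
Proof.
move=> nv; apply/forallP/forallP => h i; first by case/andP: (h i).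
rewrite h -(bary_sum R d v x nv) (bigD1 i)//= lerDl; exact: sumr_ge0.
Qed.

Lemma in_cone_perm (s : {perm 'I_d.+1}) l : in_cone (col_perm s l) = in_cone l.
Proof.
apply/forallP/forallP => h i; last by rewrite mxE.
by have := h ((s^-1)%g i); rewrite mxE permKV.
Qed.

Lemma meas_row_perm (s : {perm 'I_d.+1}) g : meas_row R d.+1 g ->
  meas_row R d.+1 (fun l => g (col_perm s l)).
Proof.
move=> mg; under [X in meas_row _ _ X]funext do rewrite col_permE.
exact: meas_row_linear.
Qed.

(* The scaling factor of a vertex permutation is found by integrating the
   permutation-invariant indicator of the simplex. *)
Lemma rint_perm v (s : {perm 'I_d.+1}) g : nondeg v -> cone_supp g ->
  rint v (fun l => g (col_perm s l)) = rint v g.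
Proof.
move=> nv ag; have ns : nondeg (v \o s) by have [] := bary_perm R d v s 0 nv.
have sE f : rint (v \o s) f = rint v (fun l => f (col_perm s l)).
  by congr fine; apply: eq_int_row => x; have [_ ->] := bary_perm R d v s x nv.
have [c c0 cE] := rint_change _ _ nv ns.
have c1 : c = 1.
  apply: (mulIf (lt0r_neq0 (rint_cone_gt0 _ nv))).
  rewrite -cE; last exact: cone_supp_cone.
  by rewrite mul1r sE; apply: eq_rint => // x; rewrite in_cone_perm.
by rewrite -sE cE// c1 mul1r.
Qed.

Lemma rint_ae v f g : nondeg v -> cone_supp f -> cone_supp g ->
  (forall l, ~~ ties R d l -> f l = g l) -> rint v f = rint v g.
Proof.
move=> nv; wlog suff : f g / cone_supp f -> cone_supp g ->
    (forall l, ~~ ties R d l -> f l = g l) -> rint v f <= rint v g.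
  move=> h af ag fg; apply/eqP; rewrite eq_le !h// => l /fg //.
move=> af ag fg; rewrite -lee_fin -!rintE//.
have [C C0 fC] := cone_supp_ub _ af.
apply: (le_int_row_ae _ _ _ _ _ C (null_ties R d v nv)) => //.
- by move=> x; exact: cone_supp_ge0.
- by move=> x; exact: cone_supp_ge0.
- by apply: meas_row_bary; case: ag.
move=> x; have [t|/fg ->] := boolP (ties R d (bary v x)); last by rewrite mulr0 addr0.
by rewrite mulr1 (le_trans (fC _))// lerDr cone_supp_ge0.
Qed.

End SimplexIntegral.

(** * The constants m1 and m2 *)

Section ElementIntegrals.
Variables (R : realType) (d : nat).
Implicit Types (v w : 'I_d.+1 -> Rpoint R d) (h : 'rV[R]_d.+1 -> R).
Implicit Types (l : 'rV[R]_d.+1) (s : {perm 'I_d.+1}) (i j k a b : 'I_d.+1).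

Let cone := @in_cone R d.

(** Here l_0 >= ... >= l_(m-1), and all these dominate the remaining coordinates. Thus [region 0] is
    the simplex, [region 1] the share of vertex 0, and [region d.+1] the completely sorted part. *)
Definition region (m : nat) l := cone l &&
  [forall i : 'I_d.+1, forall j : 'I_d.+1,
    ((i < m) && (i < j))%N ==> (l 0 j <= l 0 i)].

Lemma regionP m l : reflect (cone l /\
    forall i j : 'I_d.+1, (i < m)%N -> (i < j)%N -> l 0 j <= l 0 i) (region m l).
Proof.
apply: (iffP andP) => -[cl h]; split=> //.
  by move=> i j im ij; move/forallP/(_ i)/forallP/(_ j) : h; rewrite im ij.
by apply/forallP => i; apply/forallP => j; apply/implyP => /andP[]; exact: h.
Qed.

Lemma meas_region m : meas_pred R d.+1 (region m).
Proof.
apply: meas_pred_and; first exact: meas_in_cone.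
apply: meas_pred_forall => i; apply: meas_pred_forall => j.
case: ((i < m) && (i < j))%N => /=; last exact: meas_pred_cst.
by apply: meas_pred_le; exact: meas_row_coord.
Qed.

Definition cone_bounded h := meas_row R d.+1 h /\
  exists C, forall l, cone l -> 0 <= h l <= C.

Lemma cone_bounded1 : cone_bounded (fun=> 1).
Proof. by split; [exact: measurable_cst | exists 1 => l _; rewrite ler01 lexx]. Qed.

Lemma cone_bounded_coord i : cone_bounded (fun l => l 0 i).
Proof. by split; [exact: meas_row_coord | exists 1 => l /forallP]. Qed.

Lemma cone_supp_bounded (P : 'rV[R]_d.+1 -> bool) h : meas_pred R d.+1 P ->
  (forall l, P l -> cone l) -> cone_bounded h ->
  cone_supp R d (fun l => (P l)%:R * h l).
Proof.
move=> mP Pc [mh [C hC]]; apply: cone_supp_pred => //; exists C => l Pl.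
by split; [exact: Pc | apply/hC/Pc].
Qed.

Lemma cone_supp_region m h : cone_bounded h ->
  cone_supp R d (fun l => (region m l)%:R * h l).
Proof.
move=> bh; apply: cone_supp_bounded => //; first exact: meas_region.
by move=> l /andP[].
Qed.

Lemma rint_region_step v (m : nat) h (mo : 'I_d.+1) : nondeg v -> mo = m :> nat ->
  cone_bounded h ->
  (forall j l, (m <= j)%N -> h (col_perm (tperm mo j) l) = h l) ->
  rint R d v (fun l => (region m l)%:R * h l) =
  #|[pred j : 'I_d.+1 | m <= j]%N|%:R *
    rint R d v (fun l => (region m.+1 l)%:R * h l).
Proof.
move=> nv mE bh hsym.
(* [dom j] adds to [region m] that coordinate [j] dominates those from [m] on; up to
   ties these sets partition [region m], and swapping [m] and [j] maps each of them
   to [region m.+1]. *)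
pose dom j l := region m l && [forall i : 'I_d.+1, (m <= i)%N ==> (l 0 i <= l 0 j)].
have domE j l : (m <= j)%N -> dom j l = region m.+1 (col_perm (tperm mo j) l).
  move=> mj; pose s := tperm mo j.
  have ss k : s (s k) = k by exact: tpermK.
  have slt (k : 'I_d.+1) : (k < m)%N -> s k = k.
    by move=> km; rewrite /s tpermD// -val_eqE /= ?mE ?gtn_eqF// (leq_trans km).
  have sge (k : 'I_d.+1) : (m <= k)%N -> (m <= s k)%N.
    move=> mk; rewrite leqNgt; apply/negP => sm.
    by have := ss k; rewrite slt// => sk; move: sm; rewrite sk ltnNge mk.
  have cE i : (col_perm s l) 0 i = l 0 (s i) by rewrite mxE.
  apply/andP/regionP => [[/regionP [cl rl] /forallP dl]|[cl rl]].
    split; first by rewrite /cone in_cone_perm.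
    move=> i k; rewrite ltnS leq_eqVlt !cE => /orP[/eqP im|im] ik.
      have -> : s i = j.
        by rewrite /s (_ : i = mo) ?tpermL//; apply: val_inj; rewrite /= im.
      by apply: (implyP (dl _)); apply: sge; rewrite -im ltnW.
    rewrite (slt i)//; apply: rl => //.
    have [km|mk] := ltnP k m; first by rewrite slt.
    exact: leq_trans im (sge _ mk).
  split.
    apply/regionP; split; first by move: cl; rewrite /cone in_cone_perm.
    move=> i k im ik; have := rl i (s k); rewrite !cE ss (slt i)//; apply.
      exact: ltnW.
    have [km|mk] := ltnP k m; first by rewrite slt.
    exact: leq_trans im (sge _ mk).
  apply/forallP => i; apply/implyP => mi.
  have [->//|ij] := eqVneq i j.
  have := rl mo (s i); rewrite !cE ss (_ : s mo = j); last exact: tpermL.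
  apply; first by rewrite mE.
  rewrite mE ltn_neqAle sge// andbT; apply: contraNneq ij => msi.
  have smi : s i = mo by apply: val_inj; rewrite /= -msi mE.
  by rewrite -(ss i) smi; apply/eqP; exact: tpermL.
have cdom j : (m <= j)%N -> cone_supp R d (fun l => (dom j l)%:R * h l).
  move=> mj; apply: cone_supp_bounded => //; last by move=> l /andP[/andP[]].
  apply: meas_pred_and; first exact: meas_region.
  apply: meas_pred_forall => i; case: (m <= i)%N => /=; last exact: meas_pred_cst.
  by apply: meas_pred_le; exact: meas_row_coord.
transitivity (rint R d v (fun l => \sum_(j : 'I_d.+1 | (m <= j)%N) (dom j l)%:R * h l)).
  apply: rint_ae => //; first exact: cone_supp_region.
    exact: cone_supp_sum.
  move=> l nt; case: (boolP (region m l)) => rl; last first.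
    by rewrite mul0r big1// => j _; rewrite /dom (negbTE rl) mul0r.
  have [j mj jmax] : exists2 j : 'I_d.+1, (m <= j)%N &
      forall i : 'I_d.+1, (m <= i)%N -> l 0 i <= l 0 j.
    have P0 : [pred j : 'I_d.+1 | (m <= j)%N] mo by rewrite /= mE.
    by case: (Order.TotalTheory.arg_maxP (fun j => l 0 j) P0)
      => j mj jmax; exists j.
  have dj : dom j l.
    by rewrite /dom rl; apply/forallP => i; apply/implyP; exact: jmax.
  rewrite (bigD1 j)//= dj big1 ?addr0// => k /andP[mk kj].
  case: (boolP (dom k l)) => [/andP[_ /forallP dk]|_]; last by rewrite mul0r.
  case/negP: nt; apply/existsP; exists k; apply/existsP; exists j.
  by rewrite kj eq_le jmax// (implyP (dk j)).
rewrite rint_sum// -sum1_card natr_sum mulr_suml; apply: eq_big => [//|j mj].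
rewrite mul1r -[RHS](rint_perm _ _ _ (tperm mo j))//; last exact: cone_supp_region.
by apply: eq_rint => // x; rewrite domE// hsym.
Qed.

(** What matters is that one [K] serves all [h]. Taking [h = 1] and [h = l_0] shows that the mean of
    l_0 over the share of vertex 0 equals its mean over the sorted part. *)
Lemma rint_region_chain v (m : nat) : nondeg v -> (m <= d)%N ->
  exists2 K : R, 0 < K & forall h, cone_bounded h ->
    (forall s l, s ord0 = ord0 -> h (col_perm s l) = h l) ->
    rint R d v (fun l => (region 1 l)%:R * h l) =
    K * rint R d v (fun l => (region m.+1 l)%:R * h l).
Proof.
move=> nv; elim: m => [|m IH] md; first by exists 1 => // h _ _; rewrite mul1r.
have [K K0 KE] := IH (ltnW md).
pose mo : 'I_d.+1 := Ordinal (md : m.+1 < d.+1)%N.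
exists (K * #|[pred j : 'I_d.+1 | m.+1 <= j]%N|%:R).
  rewrite mulr_gt0// ltr0n; apply/card_gt0P; exists mo.
  by rewrite inE.
move=> h bh hs; rewrite KE// (rint_region_step _ _ _ mo)// ?mulrA// => j l mj.
apply: hs; rewrite tpermD// -val_eqE //=.
by case: (nat_of_ord j) mj.
Qed.

(** By symmetry all coordinates have the same integral, and together they sum to 1. *)
Lemma rint_cone_coord v k : nondeg v ->
  rint R d v (fun l => (cone l)%:R * l 0 k) =
  d.+1%:R^-1 * rint R d v (fun l => (cone l)%:R).
Proof.
move=> nv.
have cs i : cone_supp R d (fun l => (cone l)%:R * l 0 i).
  apply: cone_supp_bounded => //; first exact: meas_in_cone.
  exact: cone_bounded_coord.
have E i : rint R d v (fun l => (cone l)%:R * l 0 i) =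
           rint R d v (fun l => (cone l)%:R * l 0 k).
  rewrite -[LHS](rint_perm _ _ _ (tperm i k))//; apply: eq_rint => // x.
  by rewrite /cone in_cone_perm mxE tpermL.
have -> : rint R d v (fun l => (cone l)%:R) =
    \sum_i rint R d v (fun l => (cone l)%:R * l 0 i).
  rewrite -rint_sum//; apply: eq_rint => // x.
  by rewrite -mulr_sumr bary_sum// mulr1.
rewrite (eq_bigr (fun=> rint R d v (fun l => (cone l)%:R * l 0 k)))//.
by rewrite sumr_const card_ord -[X in _ * X]mulr_natl mulKf// pnatr_eq0.
Qed.

Definition mean_mx : 'M[R]_d.+1 := \matrix_(i, k) ((k <= i)%N%:R / i.+1%:R).

(* The vertices of the part of the simplex where the barycentric coordinates are
   decreasing. *)
Definition mean_vertices v i : Rpoint R d := \sum_k mean_mx i k *: v k.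

Lemma simplex_mx_mean v : simplex_mx (mean_vertices v) = mean_mx *m simplex_mx v.
Proof.
apply/matrixP => i j; rewrite [RHS]mxE.
under [RHS]eq_bigr do rewrite [simplex_mx _ _ _]mxE.
rewrite [LHS]mxE; case: splitP => j' _.
  rewrite mxE; under eq_bigr do rewrite !mxE mulr1.
  rewrite -mulr_suml -[LHS](@divff _ (i.+1%:R : R)) ?pnatr_eq0//; congr (_ / _).
  rewrite -natr_sum -big_mkcond /= sum1_card; congr (_%:R).
  by rewrite -[LHS](card_ord i.+1) -!sum1_card (big_ord_widen d.+1 (fun=> 1%N)).
rewrite mxE summxE; apply: eq_bigr => k _; by rewrite !mxE.
Qed.

Lemma nondeg_mean v : nondeg v -> nondeg (mean_vertices v).
Proof.
move=> nv; rewrite /Defs.nondegenerate simplex_mx_mean unitmx_mul nv andbT.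
rewrite unitmxE det_trig; last first.
  by apply/is_trig_mxP => i j ij; rewrite mxE leqNgt ij mul0r.
rewrite unitfE; apply/prodf_neq0 => i _.
by rewrite mxE leqnn mul1r invr_eq0 pnatr_eq0.
Qed.

Lemma bary_mean v x : nondeg v -> bary v x = bary (mean_vertices v) x *m mean_mx.
Proof.
move=> nv; apply: bary_unique => //.
by rewrite -mulmxA -simplex_mx_mean bary_mul//; exact: nondeg_mean.
Qed.

(** With respect to the mean vertices the coordinates are nu_i = (i + 1) (l_i - l_(i+1)), where
    l_(d+1) = 0. They are nonnegative exactly when l is decreasing and its last entry is
    nonnegative. *)
Lemma region_mean v x : nondeg v ->
  region d.+1 (bary v x) = cone (bary (mean_vertices v) x).
Proof.
move=> nv; have nw := nondeg_mean _ nv; set nu := bary (mean_vertices v) x.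
(* Indexing by [nat] extends the coordinates by 0 beyond [d], so the difference formula [muS] also
   covers the last index. *)
pose mu (m : nat) := \sum_k nu 0 k * ((m <= k)%N%:R / k.+1%:R).
have lE i : bary v x 0 i = mu i.
  rewrite bary_mean// -/nu mxE; apply: eq_bigr => k _; by rewrite [mean_mx _ _]mxE.
have muS (i : 'I_d.+1) : mu i - mu i.+1 = nu 0 i / i.+1%:R.
  rewrite /mu -sumrB (bigD1 i)//= leqnn ltnn mul0r mulr0 subr0 mul1r.
  rewrite big1 ?addr0// => k ki; rewrite (leq_eqVlt i k) eq_sym.
  by rewrite [(k : nat) == i](negbTE ki) orFb subrr.
rewrite [RHS]in_coneE//; apply/regionP/forallP => [[cl rl] i|nu0].
  have : mu i.+1 <= mu i.
    have [id|di] := ltnP i.+1 d.+1.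
      by rewrite -(lE (Ordinal id)) -(lE i); apply: rl.
    rewrite [leLHS]big1 => [|k _]; last first.
      by rewrite leqNgt (leq_trans (ltn_ord k) di) mul0r mulr0.
    by rewrite -lE; case/andP: (forallP cl i).
  by rewrite -subr_ge0 muS pmulr_lge0// invr_gt0 ltr0Sn.
have inv0 (k : 'I_d.+1) : 0 <= (k.+1%:R^-1 : R) by rewrite invr_ge0 ler0n.
split.
  rewrite /cone in_coneE//; apply/forallP => i; rewrite lE; apply: sumr_ge0 => k _.
  by rewrite mulr_ge0// mulr_ge0// ler0n.
move=> i j _ ij; rewrite !lE; apply: ler_sum => k _.
rewrite ler_wpM2l// ler_wpM2r// ler_nat.
by have [jk|//] := leqP j k; rewrite (ltnW (leq_trans ij jk)).
Qed.

Lemma rint_mean v h : nondeg v ->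
  rint R d v (fun l => (region d.+1 l)%:R * h l) =
  rint R d (mean_vertices v) (fun l => (cone l)%:R * h (l *m mean_mx)).
Proof.
move=> nv; congr fine; apply: eq_int_row => x.
by rewrite region_mean// -bary_mean.
Qed.

(** In the coordinates nu of the mean vertices, l_0 is the sum of nu_k / (k + 1), and each nu_k has
    mean 1 / (d + 1) on that simplex. *)
Lemma rint_region_last v : nondeg v ->
  rint R d v (fun l => (region d.+1 l)%:R * l 0 ord0) =
  d.+1%:R^-1 * harm R d.+1 * rint R d v (fun l => (region d.+1 l)%:R * 1).
Proof.
move=> nv; have nw := nondeg_mean _ nv.
rewrite (rint_mean _ (fun l => l 0 ord0))// (rint_mean _ (fun=> 1))//.
have cs i : cone_supp R d (fun l => (cone l)%:R * l 0 i).
  apply: cone_supp_bounded => //; first exact: meas_in_cone.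
  exact: cone_bounded_coord.
have k0 (k : 'I_d.+1) : 0 <= (k.+1%:R^-1 : R) by rewrite invr_ge0 ler0n.
transitivity (rint R d (mean_vertices v)
    (fun l => \sum_(k < d.+1) k.+1%:R^-1 * ((cone l)%:R * l 0 k))).
  apply: eq_rint => // x; rewrite mxE mulr_sumr; apply: eq_bigr => k _.
  by rewrite [mean_mx _ _]mxE leq0n mul1r; ring.
rewrite rint_sum//; last by move=> i _; exact: cone_suppZ.
transitivity (\sum_(k < d.+1) k.+1%:R^-1 * (d.+1%:R^-1 *
    rint R d (mean_vertices v) (fun l => (cone l)%:R))).
  by apply: eq_bigr => k _; rewrite rintZ// rint_cone_coord.
rewrite -mulr_suml /harm big_add1 /= big_mkord.
have -> : rint R d (mean_vertices v) (fun l => (cone l)%:R * 1) =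
    rint R d (mean_vertices v) (fun l => (cone l)%:R).
  by apply: eq_rint => // x; rewrite mulr1.
by rewrite mulrA [_^-1 * \sum_(_ < _) _]mulrC.
Qed.

(** The piece of the dual cell of vertex [a] inside one element. *)
Definition top a l := cone l && [forall i, l 0 i <= l 0 a].

Lemma top_region l : top ord0 l = region 1 l.
Proof.
apply/andP/regionP => -[cl h]; split=> //.
  by move=> i j; rewrite ltnS leqn0 => i0 _; rewrite (_ : i = ord0) ?(forallP h)//;
    apply/val_inj/eqP.
apply/forallP => i; have [->//|i0] := eqVneq i ord0.
by apply: h => //; rewrite lt0n.
Qed.

Lemma col_perm_coord s l i : col_perm s l 0 i = l 0 (s i).
Proof. by rewrite mxE. Qed.

Lemma top_perm a s l : top a (col_perm s l) = top (s a) l.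
Proof.
rewrite /top /cone in_cone_perm; congr andb; apply/forallP/forallP => h i.
  by have := h ((s^-1)%g i); rewrite !mxE permKV.
by rewrite !mxE.
Qed.

Lemma cone_supp_top a b : cone_supp R d (fun l => (top a l)%:R * l 0 b).
Proof.
apply: cone_supp_bounded; last exact: cone_bounded_coord.
  apply: meas_pred_and; first exact: meas_in_cone.
  by apply: meas_pred_forall => i; apply: meas_pred_le; exact: meas_row_coord.
by move=> l /andP[].
Qed.

Lemma harmS : harm R d.+1 = harm R d + d.+1%:R^-1.
Proof. by rewrite /harm big_nat_recr. Qed.

(** The diagonal value is the volume share [D / (d + 1)] of a dual piece times the mean of l_0
    there. The off-diagonal values in a row agree by symmetry, and with the diagonal one they add up
    to that share because the coordinates sum to 1. *)
Lemma element_integral v a b : nondeg v -> (0 < d)%N ->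
  rint R d v (fun l => (top a l)%:R * l 0 b) =
  rint R d v (fun l => (cone l)%:R) * (if a == b then m1 R d else m2 R d).
Proof.
move=> nv d0.
pose F a b := rint R d v (fun l => (top a l)%:R * l 0 b); rewrite -/(F a b).
set D := rint _ _ _ _.
have n0 : d.+1%:R != 0 :> R by rewrite pnatr_eq0.
have dn0 : d%:R != 0 :> R by rewrite pnatr_eq0 -lt0n.
have Fs s a' b' : F (s a') (s b') = F a' b'.
  rewrite /F -[RHS](rint_perm _ _ _ s)//; last exact: cone_supp_top.
  by apply: eq_rint => // x; rewrite top_perm col_perm_coord.
have T1 : rint R d v (fun l => (region 1 l)%:R * 1) = D / d.+1%:R.
  have : D = rint R d v (fun l => (region 0 l)%:R * 1).
    apply: eq_rint => // x; rewrite mulr1; congr (_%:R); congr nat_of_bool.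
    apply/idP/regionP => [cl|[]//]; by split.
  rewrite (rint_region_step _ 0 _ ord0)//; last exact: cone_bounded1.
  rewrite (_ : #|_| = d.+1); last by rewrite -[RHS]card_ord; apply: eq_card.
  by move=> ->; rewrite mulrC mulKf.
have F00 : F ord0 ord0 = D / d.+1%:R * (d.+1%:R^-1 * harm R d.+1).
  (* [K] cancels: it relates both the integral of l_0 and the volume [T1] to the sorted part. *)
  have [K K0 KE] := rint_region_chain v d nv (leqnn d).
  have -> : F ord0 ord0 = rint R d v (fun l => (region 1 l)%:R * l 0 ord0).
    by apply: eq_rint => // x; rewrite top_region.
  rewrite KE; [|exact: cone_bounded_coord|by move=> s l s0; rewrite mxE s0].
  rewrite rint_region_last// -T1 KE; [|exact: cone_bounded1|by []].
  by ring.
have Faa a' : F a' a' = D * m1 R d.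
  have -> : F a' a' = F ord0 ord0 by rewrite -(Fs (tperm ord0 a')) tpermR.
  rewrite F00 harmS /m1; field.
  by rewrite nat1r.
have [<-|ab] := eqVneq a b; first exact: Faa.
have Fab c : c != a -> F a c = F a b.
  by move=> ca; rewrite -(Fs (tperm b c)) tpermR tpermD// eq_sym.
have sumF : \sum_c' F a c' = D / d.+1%:R.
  rewrite -T1 -rint_sum//; last by move=> *; exact: cone_supp_top.
  rewrite -[LHS](rint_perm _ _ _ (tperm a ord0))//; last first.
    by apply: cone_supp_sum => *; exact: cone_supp_top.
  apply: eq_rint => // x; rewrite -mulr_sumr top_perm tpermL top_region.
  congr (_ * _); rewrite -(bary_sum R d v x nv).
  rewrite (reindex_inj (@perm_inj _ (tperm a ord0))) /=.
  by apply: eq_bigr => i _; rewrite col_perm_coord tpermK.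
have : F a a + d%:R * F a b = D / d.+1%:R.
  rewrite -sumF (bigD1 a)//=; congr +%R.
  rewrite (eq_bigr (fun=> F a b)) => [|k ka]; last exact: Fab.
  rewrite sumr_const mulr_natl; congr (_ *+ _).
  by rewrite (eq_card (B := predC1 a))// cardC1 card_ord.
rewrite Faa => E; apply: (mulfI dn0).
have -> : d%:R * F a b = D / d.+1%:R - D * m1 R d by rewrite -E addrC addKr.
rewrite /m1 /m2; field.
by rewrite nat1r n0 dn0.
Qed.

End ElementIntegrals.

(** * Assembly of the mass matrix *)

Section MassMatrix.
Variables (R : realType) (d nv ne : nat).
Variables (V : 'I_nv -> Rpoint R d) (E : 'I_ne -> 'I_d.+1 -> 'I_nv).
Variable phi : 'I_nv -> Rpoint R d -> R.
Hypotheses (d0 : (0 < d)%N) (mesh : simplicial_mesh V E).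
Hypothesis basis : nodal_basis V E phi.

Let cone := @in_cone R d.

Lemma elem_nondeg k : nondeg (elem V E k).
Proof. by case: mesh => _ [_ [nd _]]. Qed.

Lemma elem_inj k : injective (E k).
Proof. by case: mesh => _ [inj _]. Qed.

Lemma in_simplexP k x :
  reflect (in_simplex (elem V E k) x) (cone (bary (elem V E k) x)).
Proof. by rewrite /cone in_coneE; [exact: forallP | exact: elem_nondeg]. Qed.

(** This contains the whole hyperplanes carrying the faces of the elements, which is more than the
    element boundaries but still null. *)
Definition on_skeleton (x : 'rV[R]_d) :=
  [exists k, exists i, bary (elem V E k) x 0 i == 0].

Lemma null_skeleton : null_pred R d on_skeleton.
Proof.
apply: null_exists => k; apply: null_exists => i; apply: null_face => //.
exact: elem_nondeg.
Qed.

(** Off the skeleton no barycentric coordinate vanishes. By conformity every vertex of [k] is then a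
    vertex of [l], which is excluded for distinct elements. *)
Lemma elem_unique k l x : ~~ on_skeleton x ->
  cone (bary (elem V E k) x) -> cone (bary (elem V E l) x) -> k = l.
Proof.
move=> nx /in_simplexP xk /in_simplexP xl; apply/eqP; apply: contraNT nx => kl.
case: mesh => _ [_ [_ [_ [distinct [conform _]]]]].
apply/existsP; exists k; apply/existsP.
apply: contrapT => nex; apply: (distinct k l kl) => i.
apply: contrapT => ni; apply: nex; exists i; apply/eqP.
apply: (conform k l x xk xl) => i'; apply/eqP => e; apply: ni.
by exists i'.
Qed.

Definition elem_term k (a b : 'I_d.+1) x : R :=
  (top R d a (bary (elem V E k) x))%:R * bary (elem V E k) x 0 b.

(** A measurable stand-in for the mass integrand. On shared faces it may count a point once per
    element, so the two are compared off the skeleton. *)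
Definition elem_sum j j' x : R := \sum_k \sum_a \sum_b
  ((E k a == j) && (E k b == j'))%:R * elem_term k a b x.

Lemma elem_term_ge0 k a b x : 0 <= elem_term k a b x.
Proof.
rewrite /elem_term; case: (boolP (top _ _ _ _)) => [/andP[/forallP/(_ b) h _]|_].
  by case/andP: h => *; rewrite mul1r.
by rewrite mul0r.
Qed.

Lemma elem_term_le1 k a b x : elem_term k a b x <= 1.
Proof.
rewrite /elem_term; case: (boolP (top _ _ _ _)) => [/andP[/forallP/(_ b) h _]|_].
  by case/andP: h => *; rewrite mul1r.
by rewrite mul0r.
Qed.

Lemma meas_elem_term k a b : meas_row R d (elem_term k a b).
Proof.
apply: (meas_row_bary _ _ _ (fun l => (top R d a l)%:R * l 0 b)).
by case: (cone_supp_top R d a b).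
Qed.

Lemma elem_sum_ge0 j j' x : 0 <= elem_sum j j' x.
Proof.
apply: sumr_ge0 => k _; apply: sumr_ge0 => a _; apply: sumr_ge0 => b _.
by rewrite mulr_ge0// elem_term_ge0.
Qed.

Lemma elem_sum_ub j j' : exists2 C, 0 <= C & forall x, elem_sum j j' x <= C.
Proof.
exists (\sum_(k < ne) \sum_(a < d.+1) \sum_(b < d.+1) 1).
  by apply: sumr_ge0 => k _; apply: sumr_ge0 => a _; apply: sumr_ge0.
move=> x; apply: ler_sum => k _; apply: ler_sum => a _; apply: ler_sum => b _.
case: (_ && _); last by rewrite mul0r.
by rewrite mul1r elem_term_le1.
Qed.

Lemma meas_elem_sum j j' : meas_row R d (elem_sum j j').
Proof.
apply: meas_row_sum => k; apply: meas_row_sum => a; apply: meas_row_sum => b.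
by apply: meas_rowM; [exact: measurable_cst | exact: meas_elem_term].
Qed.

Definition mass_integrand j j' x : R := \1_(dual_cell V E j) x * phi j' x.

Lemma dual_cellP j x : dual_cell V E j x <->
  exists k a, E k a = j /\ top R d a (bary (elem V E k) x).
Proof.
split=> [[k [a [Ea [/in_simplexP xk h]]]]|[k [a [Ea /andP[xk /forallP h]]]]].
  by exists k, a; split=> //; apply/andP; split=> //; apply/forallP.
by exists k, a; split=> //; split=> //; apply/in_simplexP.
Qed.

Lemma mass_integrand_bounds j j' x : 0 <= mass_integrand j j' x <= 1.
Proof.
rewrite /mass_integrand indicE.
case: (boolP (x \in dual_cell V E j)) => [|_]; last by rewrite mul0r lexx ler01.
rewrite inE => -[k [a [_ [xk _]]]]; rewrite mul1r.
case: basis => /(_ j' k x xk) -> _; apply/andP; split.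
  by apply: sumr_ge0 => b _; rewrite mulr_ge0.
rewrite -[leRHS](bary_sum R d _ x (elem_nondeg k)); apply: ler_sum => b _.
by case: (E k b == j'); rewrite ?mul1r ?mul0r//; exact: xk.
Qed.

Lemma mass_integrandE j j' x : ~~ on_skeleton x ->
  mass_integrand j j' x = elem_sum j j' x.
Proof.
move=> nx; rewrite /mass_integrand indicE.
have [[k xk]|nk] := pselect (exists k, cone (bary (elem V E k) x)); last first.
  rewrite memNset ?mul0r => [|[k [a [_ [/in_simplexP xk _]]]]]; last first.
    by apply: nk; exists k.
  rewrite /elem_sum big1// => k _; rewrite big1// => a _; rewrite big1// => b _.
  rewrite /elem_term; case: (boolP (top _ _ _ _)) => [/andP[xk _]|_].
    by case: nk; exists k.
  by rewrite mul0r mulr0.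
rewrite /elem_sum (bigD1 k)//= [X in _ + X]big1 ?addr0; last first.
  move=> l lk; rewrite big1// => a _; rewrite big1// => b _; rewrite /elem_term.
  case: (boolP (top _ _ _ _)) => [/andP[xl _]|_]; last by rewrite mul0r mulr0.
  by move: lk; rewrite (elem_unique l k x) ?eqxx.
rewrite (basis.1 j' k x (in_simplexP _ _ xk)).
case: (boolP (x \in dual_cell V E j)) => [|xj].
  rewrite inE => /dual_cellP [l [a [Ea ta]]].
  have lk : l = k by apply: (elem_unique l k x) => //; case/andP: ta.
  rewrite {l}lk in Ea ta; rewrite mul1r [RHS](bigD1 a)//= [X in _ + X]big1 ?addr0.
     apply: eq_bigr => b _; rewrite Ea eqxx /= /elem_term ta mul1r.
    by [].
  move=> a' a'a; rewrite big1// => b _.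
  rewrite -Ea (inj_eq (@elem_inj k)) (negbTE a'a) /=.
  by rewrite mul0r.
rewrite mul0r big1// => a _; rewrite big1// => b _.
case: eqP => [Ea|_]; last by rewrite mul0r.
rewrite /elem_term; case: (boolP (top _ _ _ _)) => [ta|_]; last by rewrite mul0r mulr0.
by case/negP: xj; rewrite inE; apply/dual_cellP; exists k, a.
Qed.

Lemma int_mass_integrand j j' :
  int_row R d (mass_integrand j j') = int_row R d (elem_sum j j').
Proof.
(* The basis functions, hence the integrand, are known only element by element:
   instead of proving the integrand measurable we squeeze it between [elem_sum]
   and the same function set to 0 on the skeleton. *)
have nZ := null_skeleton; have mZ := nZ.1.
have f0 x : 0 <= mass_integrand j j' x by case/andP: (mass_integrand_bounds j j' x).
have g0 x := elem_sum_ge0 j j' x.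
have [C C0 gC] := elem_sum_ub j j'.
apply/eqP; rewrite eq_le; apply/andP; split.
  apply: (le_int_row_ae _ _ _ _ _ 1 nZ) => //; first exact: meas_elem_sum.
  move=> x; have [zx|nzx] := boolP (on_skeleton x).
    by rewrite mulr1 (le_trans (andP (mass_integrand_bounds j j' x)).2)// lerDr.
  by rewrite mass_integrandE// mulr0 addr0.
pose g' x := (~~ on_skeleton x)%:R * elem_sum j j' x.
have g'0 x : 0 <= g' x by rewrite mulr_ge0.
apply: (@le_trans _ _ (int_row R d g')).
  apply: (le_int_row_ae _ _ _ _ _ C nZ) => //.
    apply: meas_rowM; last exact: meas_elem_sum.
    by apply: meas_row_pred; exact: measurable_neg.
  move=> x; rewrite /g'; case: (on_skeleton x) => /=.
    by rewrite mul0r add0r mulr1.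
  by rewrite mul1r mulr0 addr0.
apply: le_int_row => // x; rewrite /g'; have [zx|nzx] := boolP (on_skeleton x).
  by rewrite mul0r.
by rewrite mul1r mass_integrandE.
Qed.

Definition elem_volume k := rint R d (elem V E k) (fun l => (cone l)%:R).

Lemma elem_volume_gt0 k : 0 < elem_volume k.
Proof. by apply: rint_cone_gt0; exact: elem_nondeg. Qed.

Lemma fvem_massE i i' : fvem_mass V E phi i i' =
  \sum_k elem_volume k * \sum_a \sum_b
    (E k a == ivertex i)%:R * (E k b == ivertex i')%:R *
    (if a == b then m1 R d else m2 R d).
Proof.
rewrite mxE; set j := ivertex i; set j' := ivertex i'.
transitivity (fine (int_row R d (elem_sum j j'))).
  by rewrite -int_mass_integrand.
rewrite int_row_sum; last 2 first.
- move=> k x; apply: sumr_ge0 => a _; apply: sumr_ge0 => b _.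
  by rewrite mulr_ge0// elem_term_ge0.
- move=> k; apply: meas_row_sum => a; apply: meas_row_sum => b.
  by apply: meas_rowM; [exact: measurable_cst | exact: meas_elem_term].
rewrite (eq_bigr (fun k => (elem_volume k * \sum_a \sum_b
    (E k a == j)%:R * (E k b == j')%:R *
    (if a == b then m1 R d else m2 R d))%:E)); first by rewrite sumEFin.
move=> k _; rewrite int_row_sum; last 2 first.
- move=> a x; apply: sumr_ge0 => b _.
  by rewrite mulr_ge0// elem_term_ge0.
- move=> a; apply: meas_row_sum => b.
  by apply: meas_rowM; [exact: measurable_cst | exact: meas_elem_term].
rewrite mulr_sumr -sumEFin; apply: eq_bigr => a _.
rewrite int_row_sum; last 2 first.
- by move=> b x; rewrite mulr_ge0// elem_term_ge0.
- by move=> b; apply: meas_rowM; [exact: measurable_cst | exact: meas_elem_term].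
rewrite mulr_sumr -sumEFin; apply: eq_bigr => b _.
rewrite int_rowZ//; last 2 first.
- by move=> x; exact: elem_term_ge0.
- exact: meas_elem_term.
transitivity (((E k a == j) && (E k b == j'))%:R%:E *
    int_bary R d (elem V E k) (fun l => (top R d a l)%:R * l 0 b)%R)%E => //.
rewrite rintE; [|exact: elem_nondeg|exact: cone_supp_top].
rewrite element_integral//; last exact: elem_nondeg.
by rewrite -EFinM; congr _%:E; rewrite -mulnb natrM -/(elem_volume k) mulrCA.
Qed.

End MassMatrix.

(** * Rayleigh quotients *)

Section Conditioning.
Variables (R : realType) (d n ne : nat).
Variables (inc : 'I_ne -> 'I_d.+1 -> 'I_n -> bool) (vol : 'I_ne -> R) (p q : R).
Hypothesis inc_fun : forall k a i i', inc k a i -> inc k a i' -> i = i'.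
Hypothesis inc_inj : forall k a b i, inc k a i -> inc k b i -> a = b.
Hypothesis inc_total : forall i, exists k a, inc k a i.
Hypothesis vol_gt0 : forall k, 0 < vol k.
Hypotheses (q_ge0 : 0 <= q) (q_lt : q < p).

Variable M : 'M[R]_n.
Hypothesis ME : forall i i', M i i' = \sum_k vol k * \sum_a \sum_b
  (inc k a i)%:R * (inc k b i')%:R * (if a == b then p else q).

Let p_gt0 : 0 < p. Proof. exact: le_lt_trans q_ge0 q_lt. Qed.

(** The value of the discrete function [x] at local vertex [a] of element [k]. A vertex that carries
    no unknown, such as one on the boundary, gets the value 0 from the empty sum. *)
Definition local_dof (x : 'rV[R]_n) k a : R := \sum_i (inc k a i)%:R * x 0 i.

Lemma mass_diagE i : M i i = \sum_k vol k * (p * \sum_a (inc k a i)%:R).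
Proof.
rewrite ME; apply: eq_bigr => k _; congr (_ * _); rewrite mulr_sumr.
apply: eq_bigr => a _; rewrite (bigD1 a)//= eqxx big1 ?addr0 => [|b ba].
  by case: (inc k a i); rewrite ?mul0r ?mulr0 ?mul1r ?mulr1.
case: (boolP (inc k a i)) => [ia|_]; last by rewrite !mul0r.
case: (boolP (inc k b i)) => [ib|_]; last by rewrite mulr0 mul0r.
by rewrite (inc_inj _ _ _ _ ia ib) eqxx in ba.
Qed.

Lemma mass_diag_gt0 i : 0 < M i i.
Proof.
have t0 k : 0 <= vol k * (p * \sum_a (inc k a i)%:R).
  by rewrite !mulr_ge0 ?sumr_ge0// ltW.
have [k [a ia]] := inc_total i.
rewrite mass_diagE (bigD1 k)//=; apply: ltr_pwDl; last exact: sumr_ge0.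
rewrite !mulr_gt0// (bigD1 a)//= ia; apply: ltr_pwDl => //.
exact: sumr_ge0.
Qed.

(** By [inc_fun] the sum has at most one nonzero term, so there are no cross terms. *)
Lemma local_dof_sqr x k a :
  local_dof x k a ^+ 2 = \sum_i (inc k a i)%:R * x 0 i ^+ 2.
Proof.
rewrite /local_dof; have [[i ia]|ni] := pselect (exists i, inc k a i); last first.
  have i0 i : inc k a i = false by apply/negP => ia; apply: ni; exists i.
  rewrite !big1 ?expr0n// => i _; by rewrite i0 mul0r.
have io i' : i' != i -> inc k a i' = false.
  by move=> ne'; apply/negP => ia'; rewrite (inc_fun _ _ _ _ ia ia') eqxx in ne'.
rewrite (bigD1 i)//= [X in _ + X]big1 => [|i' /io ->]; last by rewrite mul0r.
rewrite [RHS](bigD1 i)//= [X in _ = _ + X]big1 => [|i' /io ->]; last by rewrite mul0r.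
by rewrite ia !mul1r !addr0.
Qed.

Lemma diag_formE (x : 'rV[R]_n) :
  \sum_i M i i * x 0 i ^+ 2 = \sum_k vol k * (p * \sum_a local_dof x k a ^+ 2).
Proof.
under eq_bigr do rewrite mass_diagE mulr_suml.
rewrite exchange_big; apply: eq_bigr => k _ /=.
under eq_bigr do rewrite -!mulrA; rewrite -!mulr_sumr; congr (_ * (_ * _)).
transitivity (\sum_i \sum_a (inc k a i)%:R * x 0 i ^+ 2).
  by apply: eq_bigr => i _; rewrite mulr_suml.
rewrite exchange_big; apply: eq_bigr => a _ /=.
by rewrite local_dof_sqr.
Qed.

(** The element matrix with [p] on the diagonal and [q] elsewhere is (p - q) I + q J, and J
    contributes the squared sum. *)
Lemma mass_formE (x : 'rV[R]_n) : (x *m M *m x^T) 0 0 =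
  \sum_k vol k * ((p - q) * (\sum_a local_dof x k a ^+ 2) +
                  q * (\sum_a local_dof x k a) ^+ 2).
Proof.
transitivity (\sum_k vol k * \sum_a \sum_b
    local_dof x k a * local_dof x k b * (if a == b then p else q)).
  pose t k i j a b := (inc k a i)%:R * x 0 i * ((inc k b j)%:R * x 0 j) *
    (if a == b then p else q).
  transitivity (\sum_j \sum_i \sum_k vol k * \sum_a \sum_b t k i j a b).
    rewrite mxE; apply: eq_bigr => j _; rewrite [(x *m M) _ _]mxE mulr_suml.
    apply: eq_bigr => i _; rewrite ME mxE mulr_sumr mulr_suml.
    apply: eq_bigr => k _; rewrite mulrCA -mulrA; congr (_ * _).
    rewrite mulr_sumr mulr_suml; apply: eq_bigr => a _.
    rewrite mulr_sumr mulr_suml; apply: eq_bigr => b _; rewrite /t.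
    by rewrite [in RHS]mulrACA [RHS]mulrAC [LHS]mulrAC [LHS]mulrC.
  transitivity (\sum_k \sum_j \sum_i vol k * \sum_a \sum_b t k i j a b).
    by rewrite [RHS]exchange_big; apply: eq_bigr => j _; rewrite exchange_big.
  apply: eq_bigr => k _.
  transitivity (vol k * \sum_j \sum_i \sum_a \sum_b t k i j a b).
    by rewrite mulr_sumr; apply: eq_bigr => j _; rewrite mulr_sumr.
  congr (_ * _).
  transitivity (\sum_a \sum_j \sum_i \sum_b t k i j a b).
    by rewrite [RHS]exchange_big; apply: eq_bigr => j _; rewrite exchange_big.
  apply: eq_bigr => a _.
  transitivity (\sum_b \sum_j \sum_i t k i j a b).
    by rewrite [RHS]exchange_big; apply: eq_bigr => j _; rewrite exchange_big.
  apply: eq_bigr => b _; rewrite big_distrlr /= [X in _ = X * _]exchange_big mulr_suml.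
  by apply: eq_bigr => j _; rewrite mulr_suml.
apply: eq_bigr => k _; congr (_ * _); set z := local_dof x k.
rewrite expr2 [X in q * X]mulr_suml !mulr_sumr -big_split; apply: eq_bigr => a _ /=.
rewrite !mulr_sumr (bigD1 a)//= eqxx [X in _ = _ + X](bigD1 a)//=.
rewrite addrA; congr +%R; first by ring.
by apply: eq_bigr => b ba; rewrite eq_sym (negbTE ba); ring.
Qed.

(** Cauchy-Schwarz against the all-ones vector. *)
Lemma sqr_sum_le (z : 'I_d.+1 -> R) :
  (\sum_a z a) ^+ 2 <= d.+1%:R * \sum_a z a ^+ 2.
Proof.
have -> : (\sum_a z a) ^+ 2 = \sum_a \sum_b z a * z b.
  by rewrite expr2 mulr_suml; apply: eq_bigr => a _; rewrite mulr_sumr.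
apply: (@le_trans _ _ (\sum_a \sum_b (z a ^+ 2 / 2 + z b ^+ 2 / 2))).
  apply: ler_sum => a _; apply: ler_sum => b _.
  by have := sqr_ge0 (z a - z b); nra.
have E (f : 'I_d.+1 -> R) :
    \sum_a \sum_b (f a + f b) = d.+1%:R * (\sum_a f a + \sum_a f a).
  under eq_bigr do rewrite big_split /= sumr_const card_ord -mulr_natl.
  by rewrite big_split /= -mulr_sumr sumr_const card_ord -[X in _ + X]mulr_natl -mulrDr.
by rewrite (E (fun a => z a ^+ 2 / 2)) -mulr_suml -splitr.
Qed.

(** Both forms are sums over elements with the same weights [vol k], so bounds on one element add up
    with no dependence on the mesh. The lower bound drops the squared sum; the upper one uses (p -
    q) + (d + 1) q = p + d q. *)
Lemma mass_form_bounds (x : 'rV[R]_n) :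
  (p - q) / p * (\sum_i M i i * x 0 i ^+ 2) <= (x *m M *m x^T) 0 0 <=
  (p + d%:R * q) / p * (\sum_i M i i * x 0 i ^+ 2).
Proof.
have pn0 : p != 0 := lt0r_neq0 p_gt0.
have pE c y s : c / p * (y * (p * s)) = y * (c * s) by field.
rewrite mass_formE diag_formE; apply/andP; split; rewrite mulr_sumr;
  apply: ler_sum => k _; rewrite pE; apply: (ler_wpM2l (ltW (vol_gt0 k))).
  by rewrite lerDl mulr_ge0// sqr_ge0.
have := sqr_sum_le (local_dof x k); set s := \sum_a _ ^+ 2 => h.
by have := ler_wpM2l q_ge0 h; rewrite -natr1; nra.
Qed.

Lemma jacobi_eigenvalue_bounds (a : R) : eigenvalue (jacobi_scaled M) a ->
  (p - q) / p <= a <= (p + d%:R * q) / p.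
Proof.
move=> /eigenvalueP [v vE v0].
set S := diag_mx (\row_i Num.sqrt (M i i)).
have Su : S \in unitmx.
  rewrite unitmxE det_diag unitfE; apply/prodf_neq0 => i _.
  by rewrite mxE lt0r_neq0// sqrtr_gt0 mass_diag_gt0.
(* In the unscaled variable the equation reads [x M = a x S^2], where [S^2] is the diagonal of [M].
   Pairing with [x] makes [a] the quotient of the two forms in [mass_form_bounds]. *)
pose x := v *m invmx S.
have vx : v = x *m S by rewrite mulmxKV.
have x0 : x != 0 by apply: contra_neq v0 => x0; rewrite vx x0 mul0mx.
have xM : x *m M = a *: (x *m S *m S).
  move: vE; rewrite /jacobi_scaled -/S => /(congr1 (mulmx^~ S)).
  by rewrite !mulmxA mulmxKV// => ->; rewrite -vx scalemxAl.
have qE : (x *m S *m S *m x^T) 0 0 = \sum_i M i i * x 0 i ^+ 2.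
  rewrite /S !mul_mx_diag mxE; apply: eq_bigr => i _; rewrite !mxE.
  by rewrite -[X in _ = X * _](sqr_sqrtr (ltW (mass_diag_gt0 i))); ring.
have q0 : 0 < \sum_i M i i * x 0 i ^+ 2.
  have /rV0Pn [i xi] := x0.
  rewrite (bigD1 i)//=; apply: ltr_pwDl.
    by rewrite mulr_gt0 ?mass_diag_gt0// exprn_even_gt0.
  by apply: sumr_ge0 => j _; rewrite mulr_ge0 ?sqr_ge0// ltW// mass_diag_gt0.
have := mass_form_bounds x; rewrite xM -scalemxAl mxE qE.
by rewrite !ler_pM2r.
Qed.

End Conditioning.

(** * Condition number and the final bound *)

Lemma cond_number_le (R : realType) n (A : 'M[R]_n) (lo hi : R) :
  0 < lo -> 0 <= hi -> (forall a, eigenvalue A a -> lo <= a <= hi) ->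
  cond_number A <= hi / lo.
Proof.
move=> lo0 hi0 h; rewrite /cond_number.
(* Without eigenvalues, as for a mesh with no interior vertex, [sup] is 0 by convention and so is
   the quotient. *)
have [->|/set0P ne] := eqVneq [set a | eigenvalue A a]%classic set0.
  by rewrite sup0 mul0r divr_ge0// ltW.
have lo_inf : lo <= inf [set a | eigenvalue A a]%classic.
  by apply: lb_le_inf => // a /h /andP[].
have sup_hi : sup [set a | eigenvalue A a]%classic <= hi.
  by apply: sup_le_ub => // a /h /andP[].
have inf0 := lt_le_trans lo0 lo_inf.
apply: (@le_trans _ _ (hi / inf [set a | eigenvalue A a]%classic)).
  by rewrite ler_wpM2r// invr_ge0 ltW.
by rewrite ler_wpM2l// lef_pV2.
Qed.

Lemma harm_ge1 (R : realType) d : (0 < d)%N -> 1 <= harm R d.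
Proof.
case: d => // d _; rewrite /harm big_nat_recl//= invr1 lerDl.
by apply: sumr_ge0 => i _; rewrite invr_ge0.
Qed.

Lemma harm_le (R : realType) d : harm R d <= d%:R.
Proof.
elim: d => [|d IH]; first by rewrite /harm big_geq.
by rewrite harmS -[leRHS]natr1 lerD// invf_le1 ?ltr0Sn// ler1n.
Qed.

(** Since H_d <= d, the second factor of [m2] is at least d^2 + 2 d - (d + 1) d = d. *)
Lemma m2_ge0 (R : realType) d : 0 <= m2 R d.
Proof.
have h := harm_le R d; have d0 : 0 <= d%:R :> R by [].
rewrite /m2 mulr_ge0 ?invr_ge0 ?mulr_ge0 ?exprn_ge0//.
rewrite -natr1; nra.
Qed.

(** Since H_d >= 1, the numerator (d + 1) H_d - d of the difference is at least 1. *)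
Lemma m1_gt_m2 (R : realType) d : (0 < d)%N -> m2 R d < m1 R d.
Proof.
move=> dp; have h := harm_ge1 R d dp.
have d0 : 0 < d%:R :> R by rewrite ltr0n.
have -> : m1 R d = m2 R d + ((d%:R + 1) * harm R d - d%:R) / (d%:R * d.+1%:R ^+ 2).
  by rewrite /m1 /m2; field; rewrite nat1r pnatr_eq0 lt0r_neq0.
rewrite ltrDl divr_gt0//; first by nra.
by rewrite mulr_gt0// exprn_gt0.
Qed.

(** A row sum of the element matrix is the volume of one dual piece, a fraction 1 / (d + 1) of the
    element. *)
Lemma m1_m2_row_sum (R : realType) d : (0 < d)%N ->
  m1 R d + d%:R * m2 R d = d.+1%:R^-1.
Proof.
move=> dp; have d0 : d%:R != 0 :> R by rewrite pnatr_eq0 -lt0n.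
by rewrite /m1 /m2; field; rewrite nat1r pnatr_eq0.
Qed.

Theorem mainTheorem14 (R : realType) (d nv ne : nat)
  (V : 'I_nv -> Rpoint R d) (E : 'I_ne -> 'I_d.+1 -> 'I_nv)
  (phi : 'I_nv -> Rpoint R d -> R) :
  (0 < d)%N ->
  simplicial_mesh V E ->
  nodal_basis V E phi ->
  cond_number (jacobi_scaled (fvem_mass V E phi)) <=
    ((m1 R d - m2 R d) * d.+1%:R)^-1.
Proof.
move=> d0 mesh basis.
have m12 := m1_gt_m2 R d d0; have m2p := m2_ge0 R d.
have m1p : 0 < m1 R d := le_lt_trans m2p m12.
have ng : 0 < (d.+1%:R : R) by rewrite ltr0Sn.
(* The target is rewritten as the quotient of the two eigenvalue bounds; the common factor 1 / m1
   cancels, and the numerator is 1 / (d + 1) by [m1_m2_row_sum]. *)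
rewrite (_ : _^-1 = (m1 R d + d%:R * m2 R d) / m1 R d / ((m1 R d - m2 R d) / m1 R d)).
  apply: cond_number_le.
  - by rewrite divr_gt0// subr_gt0.
  - by rewrite m1_m2_row_sum// divr_ge0// ?invr_ge0 ltW.
  move=> a; apply: (jacobi_eigenvalue_bounds _ _ _ _
    (fun k a i => E k a == ivertex i) (elem_volume R d nv ne V E)) => //.
  - by move=> k b i i' /eqP -> /eqP /enum_val_inj.
  - move=> k b c i /eqP bi /eqP ci; apply: (elem_inj _ _ _ _ _ _ mesh k).
    by rewrite bi ci.
  - move=> i; case: mesh => _ [_ [_ [cover _]]].
    by have [k [b kb]] := cover (ivertex i); exists k, b; apply/eqP.
  - by move=> k; exact: elem_volume_gt0.
  - exact: fvem_massE.
rewrite m1_m2_row_sum//; field.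
by rewrite nat1r !lt0r_neq0// subr_gt0.
Qed.
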